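(* Let $E: BLip(\mathbb{R})\to QC(\mathbb{H})$ be a map satisfying: (P1) for every $f\in BLip(\mathbb{R})$, $\lim_{y\to0^+}Ef(x+iy)=f(x)$ uniformly for $x$ in compact sets of $\mathbb{R}$; (P2) $E(a\,\mathrm{Id}+b)(z)=az+b$ for every $a>0$, $b\in\mathbb{R}$; (P3) $E(f\circ g)=Ef\circ Eg$ for all $f,g\in BLip(\mathbb{R})$; (P4)* if $f_n,f\in BLip(\mathbb{R})$ and $f_n\to f$ uniformly on compact sets of $\mathbb{R}$, then $Ef_n(z)\to Ef(z)$ for all $z\in\mathbb{H}$. (i) If there are $z_0\in\mathbb{H}$, $\varepsilon_0\in(0,1)$ and a linear functional $\Lambda:C^\infty_c(\mathbb{R})\to\mathbb{C}$ such that $E(\mathrm{Id}+\varphi)(z_0)=z_0+\Lambda(\varphi)$ for every $\varphi\in\mathcal{B}_\infty(\varepsilon_0)$, then there exist $a\in\mathbb{R}$ and $\alpha\ge0$ such that $Ef=\mathcal{E}_{a,\alpha}f$ for all $f\in BL_+(\mathbb{R})$. (ii) If there are $z_0\in\mathbb{H}$, $\varepsilon_0\in(0,1)$, a bounded linear functional $\Lambda:C^1_0(\mathbb{R})\to\mathbb{C}$ and a function $R:\mathcal{B}_\infty(\varepsilon_0)\to\mathbb{C}$ such that $E(\mathrm{Id}+\varphi)(z_0)=z_0+\Lambda(\varphi)+R(\varphi)$ for every $\varphi\in\mathcal{B}_\infty(\varepsilon_0)$, and such that for every $c>0$ there is $\varepsilon\in(0,\varepsilon_0)$ with $|R(\varphi)|\le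 c\|\varphi'\|_\infty^2$ for all $\varphi\in\mathcal{B}_\infty(\varepsilon)$, then there exist $a\in\mathbb{R}$ and $\alpha\ge0$ such that $\Lambda(\varphi)=\mathcal{E}_{a,\alpha}\varphi(z_0)$ for all $\varphi\in C^1_0(\mathbb{R})$.
   Context: $\mathbb{H}=\{z=x+iy: x\in\mathbb{R},\ y>0\}$; $\mathrm{Id}$ is the identity function. $BLip(\mathbb{R})$ is the group of increasing bi-Lipschitz homeomorphisms of $\mathbb{R}$ ($f:\mathbb{R}\to\mathbb{R}$ is bi-Lipschitz if there is $c\ge1$ with $c^{-1}|x-y|\le|f(x)-f(y)|\le c|x-y|$ for all $x,y$). $BL_+(\mathbb{R})\subset BLip(\mathbb{R})$ is the set of $f\in C^1(\mathbb{R})$ for which there are $b,B>0$ with $b\le f'(x)\le B$ for all $x\in\mathbb{R}$. $QC(\mathbb{H})$ is the set of homeomorphisms $F:\mathbb{H}\to\mathbb{H}$ (onto) with $F\in W^{1,2}_{loc}(\mathbb{H})$ for which there is $k<1$ such that $|\partial_{\bar z}F|\le k|\partial_zF|$ almost everywhere on $\mathbb{H}$. $C^\infty_c(\mathbb{R})$ is the real vector space of infinitely differentiable compactly supported functions $\varphi:\mathbb{R}\to\mathbb{R}$, and $\mathcal{B}_\infty(\varepsilon)=\{\varphi\in C^\infty_c(\mathbb{R}):\|\varphi'\|_\infty<\varepsilon\}$. $C^1_0(\mathbb{R})$ is the real Banach space of $C^1$ functions $\varphi:\mathbb{R}\to\mathbb{R}$ such that $\varphi$ and $\varphi'$ both converge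 to zero at $\pm\infty$, with norm $\|\varphi\|_{1,\infty}=\|\varphi\|_\infty+\|\varphi'\|_\infty$. For $a\in\mathbb{R}$, $\alpha>0$, $z=x+iy\in\mathbb{H}$ and any $C^1$ function $f:\mathbb{R}\to\mathbb{R}$, $$\mathcal{E}_{a,\alpha}f(z)=(1-\tfrac a\alpha)f(x+ay)+\tfrac a\alpha f(x-(\alpha-a)y)+\tfrac i\alpha f(x+ay)-\tfrac i\alpha f(x-(\alpha-a)y),$$ and for $\alpha=0$, $$\mathcal{E}_{a,0}f(z)=f(x+ay)-ay f'(x+ay)+iyf'(x+ay).$$ *)

(* Defs.v *)
From HB Require Import structures.
From mathcomp Require Export all_boot all_order all_algebra.
From mathcomp Require Export all_classical all_reals all_analysis.
From mathcomp Require Export complex.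
Export numFieldNormedType.Exports.
Export Order.TTheory GRing.Theory Num.Theory.

Set Implicit Arguments.
Unset Strict Implicit.
Unset Printing Implicit Defensive.

Local Open Scope ring_scope.
Local Open Scope complex_scope.
Local Open Scope classical_set_scope.

(** The topology of the complex plane [R[i]] is the one given by its modulus,
    which the library attaches to the alias [R[i]^o]. *)

Definition homeo_on (T : topologicalType) (A : set T) (f : T -> T) : Prop :=
  exists g : T -> T,
    [/\ (forall x, A x -> A (f x) /\ g (f x) = x),
        (forall y, A y -> A (g y) /\ f (g y) = y),
        {within A, continuous f} & {within A, continuous g}].

Definition upper_half_plane (R : realType) : set R[i] :=
  [set z | 0 < complex.Im z].

Section real_line.
Variable R : realType.
Implicit Types (f phi : R -> R) (e : R).

Definition bilipschitz f : Prop :=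
  exists2 c : R, 1 <= c &
    forall x y, c^-1 * `|x - y| <= `|f x - f y| <= c * `|x - y|.

Definition BLip : set (R -> R) :=
  [set f : R -> R | [/\ {homo f : x y / x < y}, homeo_on setT f & bilipschitz f]].

Definition C1 f : Prop :=
  (forall x, derivable f x 1) /\ continuous f^`().

Definition BLplus : set (R -> R) :=
  [set f : R -> R | C1 f /\ exists b B : R,
     [/\ 0 < b, 0 < B & forall x, b <= f^`() x <= B]].

Definition Cinf f : Prop := forall (n : nat) (x : R), derivable f^`(n) x 1.

Definition Cinf_c : set (R -> R) :=
  [set phi : R -> R | Cinf phi /\ compact (closure [set x | phi x != 0])].

(** Only ever applied to bounded functions: [sup] of an unbounded set is a
    junk value. *)
Definition supnorm f : R := sup (range (fun x => `|f x|)).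

Definition Binf e : set (R -> R) :=
  [set phi : R -> R | Cinf_c phi /\ supnorm phi^`() < e].

Definition C1_0 : set (R -> R) :=
  [set phi : R -> R | [/\ C1 phi,
     phi x @[x --> +oo] --> (0 : R), phi x @[x --> -oo] --> (0 : R),
     phi^`() x @[x --> +oo] --> (0 : R) & phi^`() x @[x --> -oo] --> (0 : R)]].

Definition norm1oo f : R := supnorm f + supnorm f^`()%classic.

(** A functional on a real vector space [V] of functions is a map on all
    functions, of which only the values on [V] are meaningful. *)
Definition linear_functional_on (V : set (R -> R)) (L : (R -> R) -> R[i]) : Prop :=
  forall (a : R) phi psi, V phi -> V psi ->
    L (fun x => a * phi x + psi x) = a%:C * L phi + L psi.

Definition bounded_functional_on_C1_0 (L : (R -> R) -> R[i]) : Prop :=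
  exists M : R, forall phi, C1_0 phi -> `|L phi| <= (M * norm1oo phi)%:C.

Definition extension (a alpha : R) f (z : R[i]) : R[i] :=
  let x := complex.Re z in let y := complex.Im z in
  if alpha == 0 then
    (f (x + a * y))%:C - (a * y * f^`()%classic (x + a * y))%:C
      + 'i * (y * f^`()%classic (x + a * y))%:C
  else
    (1 - a / alpha)%:C * (f (x + a * y))%:C
      + (a / alpha)%:C * (f (x - (alpha - a) * y))%:C
      + 'i / alpha%:C * (f (x + a * y))%:C
      - 'i / alpha%:C * (f (x - (alpha - a) * y))%:C.

End real_line.

Section quasiconformal.
Variable R : realType.
Local Notation H := [set p : R * R | 0 < p.2].

Local Notation mu := (@lebesgue_measure R \x @lebesgue_measure R)%E.

(** [true] stands for the x-derivative, [false] for the y-derivative; words of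
    booleans enumerate all iterated partial derivatives. *)
Definition iter_partial (s : seq bool) (phi : R * R -> R) : R * R -> R :=
  foldr (fun (b : bool) (g : R * R -> R) =>
    'D_((if b then (1, 0) else (0, 1)) : R * R) g) phi s.

Definition smooth2 (phi : R * R -> R) : Prop :=
  forall s : seq bool,
    continuous (iter_partial s phi) /\
    forall p, derivable (iter_partial s phi) p ((1, 0) : R * R) /\
              derivable (iter_partial s phi) p ((0, 1) : R * R).

Definition test_function (phi : R * R -> R) : Prop :=
  [/\ smooth2 phi, compact (closure [set p | phi p != 0]) &
      closure [set p | phi p != 0] `<=` H].

Definition L2loc (u : R * R -> R) : Prop :=
  measurable_fun H u /\
  forall K : set (R * R), compact K -> K `<=` H ->
    (\int[mu]_(p in K) ((u p) ^+ 2)%:E < +oo)%E.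

Definition weak_partial (v : R * R) (u g : R * R -> R) : Prop :=
  forall phi, test_function phi ->
    Rintegral mu H (fun p => u p * 'D_v phi p) =
    - Rintegral mu H (fun p => g p * phi p).

(** [u] is in W^{1,2}_loc(H), with weak partial derivatives [ux], [uy]. *)
Definition W12loc_with (u ux uy : R * R -> R) : Prop :=
  [/\ L2loc u, L2loc ux, L2loc uy,
      weak_partial (1, 0) u ux & weak_partial (0, 1) u uy].

Definition of_plane (F : R[i] -> R[i]) (p : R * R) : R[i] := F (p.1 +i* p.2).

Definition Wdz (Fx Fy : R * R -> R[i]) (p : R * R) : R[i] :=
  (Fx p - 'i * Fy p) / 2.

Definition Wdzbar (Fx Fy : R * R -> R[i]) (p : R * R) : R[i] :=
  (Fx p + 'i * Fy p) / 2.

(** Only the values of [F] on the upper half-plane are meaningful. *)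
Definition QC : set (R[i] -> R[i]) :=
  [set F : R[i] -> R[i] | homeo_on (T := R[i]^o) (@upper_half_plane R) F /\
    exists Fx Fy : R * R -> R[i],
    [/\ W12loc_with (@complex.Re R \o of_plane F)
                    (@complex.Re R \o Fx) (@complex.Re R \o Fy),
        W12loc_with (@complex.Im R \o of_plane F)
                    (@complex.Im R \o Fx) (@complex.Im R \o Fy) &
        exists2 k : R, k < 1 &
          {ae mu, forall p, H p ->
             `|Wdzbar Fx Fy p| <= k%:C * `|Wdz Fx Fy p|}]].

End quasiconformal.

(* Main.v *)
Require Import Defs.
From mathcomp Require Import ring lra.

(** Write [w = E (Id + psi) z0 = A z0] with [A] increasing affine. Since [E] is
    multiplicative and fixes affine maps, composing with [Id + phi] compares
    [L (phi o (Id + psi))] with [L (phi o A)]. When [L psi = 0] the map [A] is the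
    identity up to second order, and for [phi = x^2 / 2] near the support of [psi]
    this gives [L (x psi) = 0]: the kernel of [L] is stable under multiplication by
    [x]. By (P4), [L] nearly takes the values [1] and [z0] on cutoffs of [1] and
    [x], so the kernel has real codimension 2 and contains [P C^oo_c] for some monic
    quadratic [P]. By (P4) again, [L] kills every function vanishing on the real
    zeros of [P]. These zeros are therefore two distinct points [p > q] (with
    fewer, a cutoff of [1] or of [x - p] gives a contradiction), and [L phi] is the
    value at [z0] of the affine interpolant of [phi] at [p] and [q]. In particular
    [alpha = 0] never occurs: (P4) excludes it.

    For (ii) one concludes by density of [C^oo_c] in [C^1_0]. For (i), density and
    (P4) give the formula for [C^1] maps close to the identity; the formula is
    stable under composition, and [f] is a product of the near-identity maps
    [f_((k+1)/n) o f_(k/n)^-1] where [f_t = (1 - t) Id + t f]. *)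

Set Implicit Arguments.
Unset Strict Implicit.
Unset Printing Implicit Defensive.

Local Open Scope ring_scope.
Local Open Scope complex_scope.
Local Open Scope classical_set_scope.

(** * Smooth functions and cutoffs *)

(** The remainder is [o(|phi'|^2)] so that coefficients of [s^2] can be compared: when [L psi = 0],
    [E (Id + s psi) z0 - z0] is [o(s^2)], and in the product with [Id + s phi] the only term of
    order [s^2] left over is [L (x psi)]. Part (i) is the case of zero remainder and shares this
    analysis. The obstacle is that the expansion is given only at [z0] and only for compactly
    supported perturbations, so [1], [x] and [x^2 / 2] are not directly available. Affine maps bring
    other points back to [z0], and cutoffs at scale [A] replace polynomials; (P4) controls them
    because [(al x + be) chi (x / A)] has a derivative bounded independently of [A >= 1]. The same
    mechanism rules out [alpha = 0]: a functional involving [phi' p] is not continuous for locally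
    uniform convergence under a bound on the derivative. *)

Section derivatives.
Variable R : realType.
Implicit Types (f g : R -> R) (x a b : R).

Lemma is_derive1D f g x a b : is_derive x 1 f a -> is_derive x 1 g b ->
  is_derive x 1 (fun y => f y + g y) (a + b).
Proof. by move=> fa gb; exact: is_deriveD. Qed.

Lemma is_derive1M f g x a b : is_derive x 1 f a -> is_derive x 1 g b ->
  is_derive x 1 (fun y => f y * g y) (a * g x + f x * b).
Proof.
move=> fa gb; apply: (is_derive_eq (is_deriveM fa gb)).
by rewrite addrC /GRing.scale/= (mulrC a).
Qed.

Lemma is_derive1N f x a : is_derive x 1 f a -> is_derive x 1 (fun y => - f y) (- a).
Proof. by move=> fa; exact: is_deriveN. Qed.

Lemma is_derive1B f g x a b : is_derive x 1 f a -> is_derive x 1 g b ->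
  is_derive x 1 (fun y => f y - g y) (a - b).
Proof. by move=> fa gb; exact: is_deriveB. Qed.

Lemma is_derive1V f x a : f x != 0 -> is_derive x 1 f a ->
  is_derive x 1 (fun y => (f y)^-1) (- a / f x ^+ 2).
Proof.
move=> f0 fa; apply: (is_derive_eq (is_deriveV f0 fa)).
by rewrite /GRing.scale/= mulrC mulrN mulNr.
Qed.

Lemma is_derive1_cmp f g x a b : is_derive (g x) 1 f a -> is_derive x 1 g b ->
  is_derive x 1 (fun y => f (g y)) (a * b).
Proof. by move=> fa gb; exact: is_derive1_comp. Qed.

Lemma is_derive1_affine (a b x : R) : is_derive x 1 (fun y => a * y + b) a.
Proof.
apply: is_derive_eq.
by rewrite addr0 /GRing.scale/= mulr1.
Qed.

Lemma derive1_eq f x a : is_derive x 1 f a -> derive1 f x = a.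
Proof. by move=> fa; rewrite derive1E derive_val. Qed.

Lemma derivable_is_derive1 f x : derivable f x 1 -> is_derive x 1 f (derive1 f x).
Proof. by rewrite derive1E; exact: derivableP. Qed.

Lemma is_derive1_mvt f (df : R -> R) : (forall x : R, is_derive x 1 f (df x)) ->
  forall x y, exists c : R, [/\ Num.min x y <= c, c <= Num.max x y & f x - f y = df c * (x - y)].
Proof.
move=> fdf.
have fc a b : {within `[a, b], continuous f}.
  by apply: continuous_subspaceT => z; apply: differentiable_continuous; apply/derivable1_diffP.
move=> x y; have [xy|/ltW yx] := leP x y.
- have [c] := @MVT_segment _ f df x y xy (fun z _ => fdf z) (fc x y).
  rewrite in_itv/= => /andP[xc cy] e; exists c; split => //.
  by rewrite -opprB e -mulrN opprB.
- have [c] := @MVT_segment _ f df y x yx (fun z _ => fdf z) (fc y x).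
  by rewrite in_itv/= => /andP[xc cy] e; exists c; split.
Qed.

Lemma is_derive1_continuous f (df : R -> R) : (forall x : R, is_derive x 1 f (df x)) ->
  continuous f.
Proof.
by move=> fdf z; apply: differentiable_continuous; apply/derivable1_diffP.
Qed.

Lemma is_derive1_lipschitz f (df : R -> R) K : (forall x : R, is_derive x 1 f (df x)) ->
  (forall x, `|df x| <= K) -> forall x y, `|f x - f y| <= K * `|x - y|.
Proof.
move=> fdf dfK x y; have [c [_ _ ->]] := is_derive1_mvt fdf x y.
by rewrite normrM ler_wpM2r.
Qed.

End derivatives.

Section smooth.
Variable R : realType.
Implicit Types (f g phi : R -> R).

(** Peeling off the first derivative lets closure under products and composition go by induction on
    [n] for all functions at once, since the derivative is again built from functions smooth up to
    [n]. *)
Fixpoint smooth_upto (n : nat) f : Prop :=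
  if n is m.+1 then (forall x, derivable f x 1) /\ smooth_upto m (derive1 f) else True.

Lemma smooth_uptoS n f (df : R -> R) : (forall x : R, is_derive x 1 f (df x)) ->
  smooth_upto n df -> smooth_upto n.+1 f.
Proof.
move=> fdf dfn; split=> //.
suff -> : derive1 f = df by [].
by apply/funext => x; rewrite derive1E derive_val.
Qed.

Lemma smooth_upto_pred n f : smooth_upto n.+1 f -> smooth_upto n f.
Proof.
elim: n f => //= n IH f [Hf Hf']; split => //.
by apply: IH.
Qed.

Lemma smooth_upto_is_derive n f : smooth_upto n.+1 f ->
  forall x : R, is_derive x 1 f (derive1 f x).
Proof. by move=> [+ _] x => /(_ x); rewrite derive1E; exact: derivableP. Qed.

Lemma smooth_upto_cst n c : smooth_upto n (fun=> c).
Proof.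
elim: n c => // n IH c.
by apply: (@smooth_uptoS _ _ (fun=> 0)).
Qed.

Lemma smooth_upto_id n : smooth_upto n id.
Proof.
case: n => // n; apply: (@smooth_uptoS _ _ (fun=> 1)) => //.
exact: smooth_upto_cst.
Qed.

Lemma smooth_uptoD n f g : smooth_upto n f -> smooth_upto n g ->
  smooth_upto n (fun x => f x + g x).
Proof.
elim: n f g => // n IH f g Hf Hg.
apply: (@smooth_uptoS n (fun x => f x + g x) (fun x : R => derive1 f x + derive1 g x : R)).
  by move=> x; exact: (is_derive1D (smooth_upto_is_derive Hf x) (smooth_upto_is_derive Hg x)).
by apply: IH; [case: Hf|case: Hg].
Qed.

Lemma smooth_uptoM n f g : smooth_upto n f -> smooth_upto n g ->
  smooth_upto n (fun x => f x * g x).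
Proof.
elim: n f g => // n IH f g Hf Hg.
apply: (@smooth_uptoS n (fun x => f x * g x) (fun x : R => derive1 f x * g x + f x * derive1 g
  x : R)).
  by move=> x; exact: (is_derive1M (smooth_upto_is_derive Hf x) (smooth_upto_is_derive Hg x)).
by apply: smooth_uptoD; apply: IH; (try exact: smooth_upto_pred); [case: Hf|case: Hg].
Qed.

Lemma smooth_upto_comp n f g : smooth_upto n f -> smooth_upto n g ->
  smooth_upto n (f \o g).
Proof.
elim: n f g => // n IH f g Hf Hg.
apply: (@smooth_uptoS n (f \o g) (fun x : R => derive1 f (g x) * derive1 g x : R)).
  by move=> x; exact: (is_derive1_cmp (smooth_upto_is_derive Hf _) (smooth_upto_is_derive Hg x)).
apply: smooth_uptoM; last by case: Hg.
by apply: IH; [case: Hf|exact: smooth_upto_pred].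
Qed.

Lemma smooth_uptoV n f : (forall x, f x != 0) -> smooth_upto n f ->
  smooth_upto n (fun x => (f x)^-1).
Proof.
move=> f0; elim: n => // n IH Hf.
apply: (@smooth_uptoS _ _ (fun x : R => (-1 * ((f x)^-1 * (f x)^-1)) * derive1 f x : R)).
  move=> x; have fx := smooth_upto_is_derive Hf x.
  apply: (is_derive_eq (is_derive1V (f0 x) fx)).
  by rewrite expr2 invfM mulN1r !mulNr mulrC.
have Hf' := smooth_upto_pred Hf.
apply: smooth_uptoM; last by case: Hf.
by apply: smooth_uptoM; [exact: smooth_upto_cst|apply: smooth_uptoM; apply: IH].
Qed.

(* [Cinf] itself is a product, which [apply] and the inference of implicit arguments
   would unfold. *)
Record smooth f : Prop := Smooth { smooth_upto_of : forall n, smooth_upto n f }.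

Lemma CinfP f : Cinf f <-> smooth f.
Proof.
split=> [Hf|[Hf] n x].
  constructor=> n.
  have H m : smooth_upto n f^`(m).
    elim: n m => //= n IH m; split; first by move=> x; exact: Hf.
    by rewrite -derive1nS; exact: IH.
  exact: (H 0%N).
elim: n f Hf => [|n IH] f Hf; first by have [+ _] := Hf 1%N; apply.
rewrite derive1Sn; apply: IH => m.
by have [_] := Hf m.+1.
Qed.

Lemma smooth_cst c : smooth (fun _ : R => c).
Proof. by constructor => n; exact: smooth_upto_cst. Qed.

Lemma smooth_id : smooth (id : R -> R).
Proof. by constructor => n; exact: smooth_upto_id. Qed.

Lemma smoothD f g : smooth f -> smooth g -> smooth (fun x => f x + g x).
Proof. by move=> [Hf] [Hg]; constructor => n; exact: smooth_uptoD. Qed.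

Lemma smoothM f g : smooth f -> smooth g -> smooth (fun x => f x * g x).
Proof. by move=> [Hf] [Hg]; constructor => n; exact: smooth_uptoM. Qed.

Lemma smoothN f : smooth f -> smooth (fun x => - f x).
Proof.
move=> Hf; have := smoothM (smooth_cst (-1)) Hf.
by under [in X in smooth X -> _]eq_fun do rewrite mulN1r.
Qed.

Lemma smoothB f g : smooth f -> smooth g -> smooth (fun x => f x - g x).
Proof. by move=> Hf Hg; exact: (smoothD Hf (smoothN Hg)). Qed.

Lemma smooth_comp f g : smooth f -> smooth g -> smooth (fun x => f (g x)).
Proof. by move=> [Hf] [Hg]; constructor => n; exact: (@smooth_upto_comp n f g). Qed.

Lemma smoothV f : (forall x, f x != 0) -> smooth f -> smooth (fun x => (f x)^-1).
Proof. by move=> f0 [Hf]; constructor => n; exact: smooth_uptoV. Qed.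

Lemma smooth_is_derive f : smooth f -> forall x : R, is_derive x 1 f (derive1 f x).
Proof. by move=> [/(_ 1%N)/smooth_upto_is_derive]. Qed.

Lemma smooth_derive1 f : smooth f -> smooth (derive1 f).
Proof. by move=> [Hf]; constructor => n; case: (Hf n.+1). Qed.

Lemma smooth_affine (a b : R) : smooth (fun x => a * x + b).
Proof. exact: (smoothD (smoothM (smooth_cst a) smooth_id) (smooth_cst b)). Qed.

Lemma smooth_comp_affine f (a b : R) : smooth f -> smooth (fun x => f (a * x + b)).
Proof. by move=> Hf; exact: (smooth_comp Hf (smooth_affine a b)). Qed.

End smooth.

Arguments smooth_id {R}.

Section cutoff.
Variable R : realType.
Implicit Types (f g phi : R -> R) (x : R).

Lemma is_derive_quadratic_bound f (C : R) : (forall x, `|f x| <= C * x ^+ 2) ->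
  is_derive (0 : R) 1 f 0.
Proof.
move=> fC; have f0 : f 0 = 0 by apply/eqP; rewrite -normr_le0 (le_trans (fC 0))// expr0n mulr0.
have C0 : 0 <= C by have := le_trans (normr_ge0 _) (fC 1); rewrite expr1n mulr1.
have H : h^-1 *: (f (h *: 1 + 0) - f 0) @[h --> 0^'] --> (0 : R).
  apply/cvgrPdist_le => e e0.
  have C1 : 0 < C + 1 by rewrite ltr_wpDl.
  have eC : 0 < e / (C + 1) by rewrite divr_gt0.
  near=> h.
  have h0 : h != 0 by near: h; exact: nbhs_dnbhs_neq.
  rewrite sub0r normrN f0 subr0 addr0 /GRing.scale/= mulr1 normrM normfV.
  rewrite ler_pdivrMl ?normr_gt0// (le_trans (fC h))//.
  rewrite -[h ^+ 2]real_normK ?num_real// expr2 mulrCA ler_wpM2l//.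
  have : `|h| < e / (C + 1) by near: h; exact: dnbhs0_lt.
  rewrite ltr_pdivlMr// => /ltW; apply: le_trans.
  by rewrite mulrC ler_wpM2l// lerDl.
apply: DeriveDef.
  by apply/cvg_ex; exists 0.
exact/cvg_lim.
Unshelve. all: by end_near.
Qed.

(** Each derivative of [exp (-1/x)] is a polynomial in [1/x] times [exp (-1/x)]; this family is
    therefore closed under differentiation up to linear combinations. *)
Definition flat (k : nat) x : R := if 0 < x then x^-1 ^+ k * expR (- x^-1) else 0.

(** This is [exp y >= y^(k+2) / (k+2)!] at [y = 1/x]. A quadratic bound is what gives derivative 0
    at the origin, where the two formulas for [flat] meet. *)
Lemma flat_bound k : exists C : R, forall x, `|flat k x| <= C * x ^+ 2.
Proof.
exists (k.+2)`!%:R => x; rewrite /flat; case: ifPn => x0; last first.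
  by rewrite normr0 mulr_ge0 ?sqr_ge0.
rewrite ger0_norm; last by rewrite mulr_ge0 ?expR_ge0// exprn_ge0// invr_ge0 ltW.
have y0 : 0 < x^-1 by rewrite invr_gt0.
rewrite expRN ler_pdivrMr ?expR_gt0//.
have := expR_ge1Dxn k.+1 (ltW y0).
have F0 : (0 : R) < (k.+2)`!%:R by rewrite ltr0n fact_gt0.
rewrite -subr_ge0 => H; rewrite -subr_ge0.
have -> : (k.+2)`!%:R * x ^+ 2 * expR x^-1 - x^-1 ^+ k =
  (k.+2)`!%:R * x ^+ 2 * ((expR x^-1 - (1 + x^-1 ^+ k.+2 / (k.+2)`!%:R)) + 1).
  rewrite !exprS; field.
  by rewrite !gt_eqF.
by apply: mulr_ge0; [apply: mulr_ge0; [exact: ltW|exact: sqr_ge0]|exact: addr_ge0].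
Qed.

Lemma is_derive_flat k x : is_derive x 1 (flat k) (flat k.+2 x - k%:R * flat k.+1 x).
Proof.
have [x0|x0|->] := ltgtP x 0.
- apply: (@near_eq_is_derive _ _ _ (fun=> 0)).
    near=> y; rewrite /flat ifF//; apply/negbTE; rewrite -leNgt ltW//.
    by near: y; exact: lt_nbhsl.
  rewrite /flat !ifF ?mulr0 ?subr0//; first exact: is_derive_cst.
  - by rewrite ltNge ltW.
  - by rewrite ltNge ltW.
- apply: (@near_eq_is_derive _ _ _ (fun y : R => (y^-1 ^+ k * expR (- y^-1) : R))).
    near=> y; rewrite /flat ifT//.
    by near: y; exact: lt_nbhsr.
  have dV : is_derive x 1 (fun y : R => y^-1) (- 1 / x ^+ 2).
    by apply: (@is_derive1V _ id); rewrite gt_eqF.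
  have dX : is_derive x 1 (fun y : R => y^-1 ^+ k) (- k%:R * x^-1 ^+ k.+1).
    elim: k => [|k IH].
      by rewrite mulNr mul0r oppr0; exact: is_derive_cst.
    under eq_fun do rewrite exprS.
    apply: (is_derive_eq (is_derive1M dV IH)).
    have xn : x != 0 by rewrite gt_eqF.
    rewrite !exprS -natr1; field.
    by rewrite xn.
  apply: (is_derive_eq (is_derive1M dX (is_derive1_cmp (is_derive_expR _) (is_derive1N dV)))).
  rewrite /flat x0 !exprS; field.
  by rewrite gt_eqF.
- have [C HC] := flat_bound k.
  rewrite /flat ltxx mulr0 subr0; exact: (is_derive_quadratic_bound HC).
Unshelve. all: by end_near.
Qed.

Lemma smooth_flat k : smooth (flat k).
Proof.
constructor => n; elim: n k => // n IH k.
apply: (smooth_uptoS (is_derive_flat k)).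
have := smooth_uptoD (IH k.+2) (smooth_uptoM (smooth_upto_cst n (- k%:R : R)) (IH k.+1)).
by under [in X in smooth_upto n X -> _]eq_fun do rewrite mulNr.
Qed.

Lemma exists_smooth_step : exists s : R -> R,
  [/\ smooth s, (forall x, 0 <= s x <= 1),
      (forall x, x <= 0 -> s x = 0) & (forall x, 1 <= x -> s x = 1)].
Proof.
pose e := flat 0.
have e0 x : x <= 0 -> e x = 0 by rewrite leNgt /e /flat => /negbTE ->.
have e1 x : 0 < x -> 0 < e x by rewrite /e /flat => ->; rewrite mul1r expR_gt0.
have ege0 x : 0 <= e x by have [/e0->//|/e1/ltW] := leP x 0.
pose d x := e x + e (1 - x).
have d0 x : 0 < d x.
  have [x0|x0] := leP x 0; rewrite /d.
    by rewrite e0// add0r e1//; lra.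
  by rewrite ltr_pwDl// e1.
pose s x := e x * (d x)^-1.
have s0 x : x <= 0 -> s x = 0 by move=> /e0 ex; rewrite /s ex mul0r.
have s1 x : 1 <= x -> s x = 1.
  by move=> x1; rewrite /s /d (e0 (1 - x)) ?addr0 ?divff ?gt_eqF ?e1//; lra.
have s01 x : 0 <= s x <= 1.
  by rewrite /s divr_ge0 ?(ltW (d0 x))//= ler_pdivrMr// mul1r lerDl.
have Cs : smooth s.
  apply: smoothM; first exact: smooth_flat.
  apply: smoothV; first by move=> x; rewrite gt_eqF.
  apply: smoothD; first exact: smooth_flat.
  exact: (smooth_comp (smooth_flat 0) (smoothB (smooth_cst 1) smooth_id)).
by exists s.
Qed.

Lemma exists_cutoff : exists chi : R -> R,
  [/\ smooth chi, (forall x, 0 <= chi x <= 1),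
      (forall x, `|x| <= 1 -> chi x = 1) & (forall x, 2 <= `|x| -> chi x = 0)].
Proof.
have [s [Cs s01 s0 s1]] := exists_smooth_step.
exists (fun x => s (2 - x) * s (2 + x)); split.
- apply: smoothM.
    exact: (smooth_comp Cs (smoothB (smooth_cst 2) smooth_id)).
  exact: (smooth_comp Cs (smoothD (smooth_cst 2) smooth_id)).
- move=> x; have /andP[a b] := s01 (2 - x); have /andP[c d'] := s01 (2 + x).
  by rewrite mulr_ge0//= mulr_ile1.
- by move=> x; rewrite ler_norml => /andP[a b]; rewrite !s1 ?mulr1//; lra.
- move=> x; rewrite ler_normr => /orP[a|a].
    by rewrite s0 ?mul0r//; lra.
  by rewrite (s0 (2 + x)) ?mulr0//; lra.
Qed.

End cutoff.

Section compact_support.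
Variable R : realType.
Implicit Types (f g phi psi : R -> R) (x : R).

Lemma continuous_bounded_on f (M : R) : continuous f ->
  exists2 K : R, 0 <= K & forall x, `|x| <= M -> `|f x| <= K.
Proof.
move=> cf; have [M0|M0] := leP 0 M; last first.
  by exists 0 => // x xM; have := le_lt_trans xM M0; rewrite normr_lt0.
have MM : - M <= M by rewrite ge0_cp.
have cn : {within `[- M, M], continuous (fun x => `|f x|)}.
  apply: continuous_subspaceT => x.
  by apply: (continuous_comp (cf x)); exact: norm_continuous.
have [c _ cmax] := EVT_max MM cn.
exists `|f c| => // x; rewrite ler_norml => xM.
by apply: cmax; rewrite in_itv.
Qed.

(** Compactness of the support is traded for a radius outside which [phi] vanishes; [0 <= M] lets
    the radii of two functions be added. *)
Record smooth_c phi : Prop := SmoothC {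
  smooth_c_smooth : smooth phi;
  smooth_c_support : exists2 M : R, 0 <= M & forall x, M < `|x| -> phi x = 0 }.

Lemma Cinf_cP phi : Cinf_c phi <-> smooth_c phi.
Proof.
split=> [[/CinfP Hf /compact_bounded [M [_ HM]]]|[Hf [M M0 HM]]].
  constructor => //; exists (`|M| + 1); first by rewrite addr_ge0.
  move=> x xM; apply/eqP/negPn/negP => fx0; move: xM; apply/negP; rewrite -leNgt.
  apply: HM; last exact: subset_closure.
  by rewrite (le_lt_trans (ler_norm _))// ltrDl.
split; first exact/CinfP.
have sub : closure [set x | phi x != 0] `<=` `[- M, M].
  have cl : closed [set` `[- M, M]%R] by exact: interval_closed.
  rewrite [X in _ `<=` X]((closure_id _).1 cl).
  apply: closureS => x /= fx0; rewrite in_itv/= -ler_norml leNgt.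
  by apply/negP => /HM fx; rewrite fx eqxx in fx0.
apply: (subclosed_compact _ (@segment_compact _ (- M) M) sub).
exact: closed_closure.
Qed.

Lemma smooth_c_Cinf_c phi : smooth_c phi -> Cinf_c phi.
Proof. by move/Cinf_cP. Qed.

Lemma smooth_cD phi psi : smooth_c phi -> smooth_c psi ->
  smooth_c (fun x => phi x + psi x).
Proof.
move=> [Hf [M M0 HM]] [Hg [N N0 HN]]; constructor; first exact: smoothD.
exists (M + N) => [|x xM]; first exact: addr_ge0.
by rewrite HM ?HN ?addr0// (le_lt_trans _ xM)// ?lerDl ?lerDr.
Qed.

Lemma smooth_cMl phi psi : smooth phi -> smooth_c psi ->
  smooth_c (fun x => phi x * psi x).
Proof.
move=> Hf [Hg [N N0 HN]]; constructor; first exact: smoothM.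
by exists N => // x xM; rewrite HN ?mulr0.
Qed.

Lemma smooth_cZ (a : R) psi : smooth_c psi -> smooth_c (fun x => a * psi x).
Proof. by move=> Hpsi; exact: (smooth_cMl (smooth_cst a) Hpsi). Qed.

Lemma smooth_cN psi : smooth_c psi -> smooth_c (fun x => - psi x).
Proof.
move=> [Hg [N N0 HN]]; constructor; first exact: smoothN.
by exists N => // x xM; rewrite HN ?oppr0.
Qed.

Lemma smooth_cB phi psi : smooth_c phi -> smooth_c psi ->
  smooth_c (fun x => phi x - psi x).
Proof. by move=> Hf Hg; exact: (smooth_cD Hf (smooth_cN Hg)). Qed.

Lemma smooth_c_comp_affine phi (a b : R) : a != 0 -> smooth_c phi ->
  smooth_c (fun x => phi (a * x + b)).
Proof.
move=> a0 [Hf [M M0 HM]]; constructor; first exact: smooth_comp_affine.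
exists ((M + `|b|) / `|a|) => [|x]; first by rewrite divr_ge0// addr_ge0.
rewrite ltr_pdivrMr ?normr_gt0// => xM; apply: HM.
rewrite -(ltrD2r `|b|) (lt_le_trans xM)// mulrC -normrM.
by rewrite -{1}[a * x](addrK b) ler_normB.
Qed.

Lemma derive1_outside_support f (M x : R) : (forall x, M < `|x| -> f x = 0) ->
  M < `|x| -> derive1 f x = 0.
Proof.
move=> HM xM; apply: derive1_eq; apply: (@near_eq_is_derive _ _ _ (fun=> 0)).
near=> y; rewrite HM//; near: y.
have : {for x, continuous (fun y : R => `|y|)} by exact: norm_continuous.
by move=> /(_ _ (lt_nbhsr xM)).
Unshelve. all: by end_near.
Qed.

Lemma smooth_c_derive1 phi : smooth_c phi -> smooth_c (derive1 phi).
Proof.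
move=> [Hf [M M0 HM]]; constructor; first exact: smooth_derive1.
by exists M => // x; exact: derive1_outside_support.
Qed.

Lemma smooth_c_bounded phi : smooth_c phi ->
  exists2 K : R, 0 <= K & forall x, `|phi x| <= K.
Proof.
move=> [Hf [M M0 HM]].
have [K K0 HK] := continuous_bounded_on M (is_derive1_continuous (smooth_is_derive Hf)).
exists K => // x; have [|/HM ->] := leP `|x| M; first exact: HK.
by rewrite normr0.
Qed.

Lemma le_supnorm f (K x : R) : (forall x, `|f x| <= K) -> `|f x| <= supnorm f.
Proof.
move=> fK; apply: sup_upper_bound; last by exists x.
split; first by exists `|f x|; exists x.
by exists K => _ [y _ <-].
Qed.

Lemma supnorm_le f (K : R) : (forall x, `|f x| <= K) -> supnorm f <= K.
Proof.
move=> fK; apply: ge_sup; first by exists `|f 0|; exists 0.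
by move=> _ [y _ <-].
Qed.

Lemma supnorm_ge0 f : 0 <= supnorm f.
Proof.
have [[K fK]|nK] := pselect (exists K, forall x, `|f x| <= K).
  by rewrite (le_trans _ (le_supnorm 0 fK)).
(* For unbounded [f] the set of values has no supremum and [sup] takes its default value 0. *)
rewrite /supnorm sup_out// => -[_ [K HK]]; apply: nK; exists K => x.
by apply: HK; exists x.
Qed.

(** The displacement [(s - 1) x + t] is unbounded in [x], but for [|x| > 2 M + 2] one has
    [|s x + t| >= |x| / 2 - 1 > M], so both values of [phi] vanish there. *)
Lemma smooth_c_affine_perturbation phi : smooth_c phi ->
  exists2 K : R, 0 <= K & forall s t : R, `|s - 1| <= 2^-1 -> `|t| <= 1 ->
    forall x, `|phi (s * x + t) - phi x| <= K * (`|s - 1| + `|t|).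
Proof.
move=> Hf; have [K K0 HK] := smooth_c_bounded (smooth_c_derive1 Hf).
case: Hf => Hf [M M0 HM].
exists (K * (2 * M + 2 + 1)) => [|s t s1 t1 x]; first by rewrite mulr_ge0// addr_ge0//
  addr_ge0// mulr_ge0.
have [xM|xM] := leP `|x| (2 * M + 2); last first.
  rewrite (HM x); last by lra.
  rewrite HM ?subrr ?normr0 ?mulr_ge0 ?addr_ge0 ?mulr_ge0//.
  have H1 : `|(s - 1) * x| <= 2^-1 * `|x| by rewrite normrM ler_wpM2r.
  have -> : s * x + t = x + ((s - 1) * x + t) by ring.
  have := lerB_normD x ((s - 1) * x + t).
  have := ler_normD ((s - 1) * x) t.
  by lra.
apply: (le_trans (is_derive1_lipschitz (smooth_is_derive Hf) HK _ _)).
rewrite -mulrA ler_wpM2l//.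
have -> : s * x + t - x = (s - 1) * x + t by ring.
rewrite (le_trans (ler_normD _ _))// normrM.
have : `|s - 1| * `|x| <= `|s - 1| * (2 * M + 2) by rewrite ler_wpM2l.
have := normr_ge0 t; have := normr_ge0 (s - 1) => h1 h2.
have : 0 <= `|t| * (2 * M + 2) by rewrite mulr_ge0// addr_ge0// mulr_ge0.
by lra.
Qed.

End compact_support.

(** * Bi-Lipschitz maps *)

Section modulus.
Variable R : realType.
Implicit Types (z w : R[i]) (a : R).

(** The norm of [R[i]] takes its values in [R[i]]; a real-valued modulus keeps the estimates within
    reach of [lra]. *)
Definition modc w : R := Normc.normc w.

Lemma modcE w : `|w| = (modc w)%:C.
Proof. by []. Qed.

Lemma modc_ge0 w : 0 <= modc w.
Proof. by rewrite -lecR -modcE normr_ge0. Qed.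

Lemma modcD w z : modc (w + z) <= modc w + modc z.
Proof. by rewrite -lecR rmorphD -!modcE ler_normD. Qed.

Lemma modcN w : modc (- w) = modc w.
Proof. by case: w => a b; rewrite /modc/= !sqrrN. Qed.

Lemma modcB w z : modc (w - z) = modc (z - w).
Proof. by rewrite -modcN opprB. Qed.

Lemma modcM w z : modc (w * z) = modc w * modc z.
Proof. exact: Normc.normcM. Qed.

Lemma modc_real a : modc a%:C = `|a|.
Proof. by rewrite /modc /= expr0n /= addr0 sqrtr_sqr. Qed.

Lemma modc_Re w : `|complex.Re w| <= modc w.
Proof. by rewrite -lecR -modcE normc_ge_Re. Qed.

Lemma modc_Im w : `|complex.Im w| <= modc w.
Proof.
case: w => a b; rewrite /modc/= -sqrtr_sqr ler_sqrt ?addr_ge0 ?sqr_ge0//.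
by rewrite lerDr sqr_ge0.
Qed.

Lemma modc_le0 w : modc w <= 0 -> w = 0.
Proof.
by move=> w0; apply: Normc.eq0_normc; apply/eqP; rewrite eq_le w0 modc_ge0.
Qed.

Lemma modc_small_eq w z : (forall e, 0 < e -> modc (w - z) <= e) -> w = z.
Proof.
move=> H; apply/eqP; rewrite -subr_eq0; apply/eqP; apply: modc_le0.
by rewrite leNgt; apply/negP => p0; have := H _ (divr_gt0 p0 (ltr0Sn _ 1)); lra.
Qed.

End modulus.

Section bilipschitz_maps.
Variable R : realType.
Implicit Types (f g phi psi : R -> R) (x : R).

Lemma lipschitz_continuous f (K : R) :
  (forall x y, `|f x - f y| <= K * `|x - y|) -> continuous f.
Proof.
move=> fK x; apply/cvgrPdist_le => e e0.
have K1 : 0 < `|K| + 1 by rewrite ltr_wpDl.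
have d0 : 0 < e / (`|K| + 1) by rewrite divr_gt0.
near=> y; rewrite (le_trans (fK _ _))//.
have : `|x - y| < e / (`|K| + 1) by near: y; exact: cvgr_dist_lt.
rewrite ltr_pdivlMr// => /ltW; apply: le_trans.
rewrite mulrC ler_wpM2l// (le_trans (ler_norm _))// lerDl//.
Unshelve. all: by end_near.
Qed.

Lemma derive_lower_bound f (df : R -> R) (b : R) :
  (forall x : R, is_derive x 1 f (df x)) ->
  (forall x, b <= df x) -> forall x y, x <= y -> b * (y - x) <= f y - f x.
Proof.
move=> fdf bdf x y xy; have [c [_ _ ->]] := is_derive1_mvt fdf y x.
by rewrite ler_wpM2r// subr_ge0.
Qed.

Lemma derive_lower_bound_dist f (df : R -> R) (b : R) : 0 < b ->
  (forall x : R, is_derive x 1 f (df x)) ->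
  (forall x, b <= df x) -> forall x y, b * `|x - y| <= `|f x - f y|.
Proof.
move=> b0 fdf bdf x y; have [c [_ _ ->]] := is_derive1_mvt fdf x y.
rewrite normrM ler_wpM2r// (le_trans _ (ler_norm _))//.
Qed.

Lemma derive_lower_bound_inverse f (df : R -> R) (b : R) : 0 < b ->
  (forall x : R, is_derive x 1 f (df x)) ->
  (forall x, b <= df x) -> exists g, cancel f g /\ cancel g f.
Proof.
move=> b0 fdf bdf; have lb := derive_lower_bound fdf bdf.
have surj y : exists x, f x = y.
  (* With slope at least [b], [f] moves by at least [b A = |y - f 0|] on each side of 0, so [y] lies
     between [f (- A)] and [f A]. *)
  pose A := `|y - f 0| / b; have A0 : 0 <= A by rewrite divr_ge0// ltW.
  have bA : b * A = `|y - f 0| by rewrite /A mulrC divfK// gt_eqF.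
  have AA : - A <= A by rewrite ge0_cp.
  have h1 := lb _ _ A0; have h2 := lb (- A) 0.
  rewrite oppr_le0 sub0r opprK in h2; have {}h2 := h2 A0.
  rewrite subr0 in h1; rewrite bA in h1 h2.
  have h3 := ler_norm (y - f 0); have h4 := ler_normr (y - f 0) (- (y - f 0)).
  have h5 : - (y - f 0) <= `|y - f 0| by rewrite -normrN ler_norm.
  have cf : {within `[- A, A], continuous f}.
    exact: (continuous_subspaceT (is_derive1_continuous fdf)).
  have fyA : Num.min (f (- A)) (f A) <= y <= Num.max (f (- A)) (f A).
    by rewrite ge_min le_max; apply/andP; split; apply/orP; [left|right]; lra.
  by have [x _ fx] := IVT AA cf fyA; exists x.
have [g gK] := choice surj.
exists g; split => // x.
have := derive_lower_bound_dist b0 fdf bdf (g (f x)) x.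
rewrite gK subrr normr0 pmulr_rle0// normr_le0 subr_eq0.
by move/eqP.
Qed.

Lemma BLip_of_derive f (df : R -> R) (b B : R) : 0 < b ->
  (forall x : R, is_derive x 1 f (df x)) ->
  (forall x, b <= df x <= B) -> BLip f.
Proof.
move=> b0 fdf bdfB.
have bdf x : b <= df x by case/andP: (bdfB x).
have dist := derive_lower_bound_dist b0 fdf bdf.
have B0 : 0 < B by have /andP[] := bdfB 0; lra.
have bi0 : 0 < b^-1 by rewrite invr_gt0.
have [g [fK gK]] := derive_lower_bound_inverse b0 fdf bdf.
split.
- move=> x y xy; rewrite -subr_gt0.
  apply: lt_le_trans (derive_lower_bound fdf bdf (ltW xy)).
  by rewrite mulr_gt0// subr_gt0.
- exists g; split => //.
    exact: (continuous_subspaceT (is_derive1_continuous fdf)).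
  apply: continuous_subspaceT; apply: (@lipschitz_continuous _ b^-1) => x y.
  by rewrite -ler_pdivrMl// invrK -{2}(gK x) -{2}(gK y).
- exists (1 + b^-1 + B) => [|x y]; first by rewrite -addrA lerDl addr_ge0// ltW.
  apply/andP; split.
    apply: le_trans (dist _ _); rewrite ler_wpM2r// -[leRHS]invrK lef_pV2 ?posrE//; lra.
  apply: (le_trans (is_derive1_lipschitz (K := B) fdf _ _ _)).
    move=> z; have /andP[h1 h2] := bdfB z.
    by rewrite ger0_norm//; lra.
  by rewrite ler_wpM2r//; lra.
Qed.

End bilipschitz_maps.

(** * Quantitative continuity of the extension *)

Section extension_operator.
Variables (R : realType) (E : (R -> R) -> R[i] -> R[i]).
Hypothesis E_cont : forall (f_ : nat -> R -> R) (f : R -> R),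
  (forall n, BLip (f_ n)) -> BLip f -> {family compact, f_ @ \oo --> f} ->
  forall z, upper_half_plane z ->
    (E (f_ n) z : R[i]^o) @[n --> \oo] --> (E f z : R[i]^o).

(** If no [N] worked, counterexamples [g_N] would converge to [f] uniformly on compact sets, against
    (P4). A single integer serves both as radius and as inverse tolerance. *)
Lemma local_uniform_continuity f z e : BLip f -> upper_half_plane z -> 0 < e ->
  exists N : nat, forall g, BLip g ->
    (forall x, `|x| <= N%:R -> `|g x - f x| <= N.+1%:R^-1) ->
    modc (E g z - E f z) <= e.
Proof.
move=> Hf Hz e0; apply/not_existsP => H.
have /choice[g_ Hg] (N : nat) : exists g, [/\ BLip g,
    forall x, `|x| <= N%:R -> `|g x - f x| <= N.+1%:R^-1 & e < modc (E g z - E f z)].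
  have := H N; rewrite -existsNE => -[g /not_implyP[Bg /not_implyP[gf /negP]]].
  by rewrite -ltNge => lt; exists g.
have g_f : {family compact, g_ @ \oo --> f}.
  apply/fam_cvgP => A /compact_bounded[M [_ AM]] P /uniform_nbhs[U [Uent UP]].
  have [d /= d0 dU] : filter_from [set d : R | 0 < d] (fun d => [set xy : R * R | ball xy.1 d
    xy.2]) U.
    by rewrite entourage_from_ballE.
  near=> n; apply: UP => x Ax; apply: dU => /=.
  have [_ gn _] := Hg n.
  have xn : `|x| <= n%:R.
    apply: (le_trans (AM (M + 1) _ x Ax)); first by rewrite ltrDl.
    by near: n; exact: nbhs_infty_ger.
  rewrite /ball/= distrC (le_lt_trans (gn x xn))//.
  by near: n; exact: near_infty_natSinv_lt (PosNum d0).
have := E_cont (fun n => let: And3 a _ _ := Hg n in a) Hf g_f Hz.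
move/cvgrPdist_le => /(_ e%:C); rewrite ltcR => /(_ e0)[n _ /(_ n (leqnn n))].
rewrite distrC modcE lecR leNgt.
by have [_ _ ->] := Hg n.
Unshelve. all: by end_near.
Qed.

End extension_operator.

(** * The kernel of the first order functional *)

Section derivative_bound.
Variable R : realType.
Implicit Types (f g phi psi : R -> R) (x : R).

(** A pointwise bound carries no boundedness side condition, unlike [supnorm]; [Binf_derive_le]
    makes the conversion. *)
Definition derive_le (K : R) phi := forall x, `|derive1 phi x| <= K.

Lemma derive_le_ge0 K phi : derive_le K phi -> 0 <= K.
Proof. by move=> /(_ 0); exact: le_trans. Qed.

Lemma derive_leW K K' phi : K <= K' -> derive_le K phi -> derive_le K' phi.
Proof. by move=> KK' H x; exact: le_trans KK'. Qed.

Lemma derive_leD K K' phi psi : smooth phi -> smooth psi ->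
  derive_le K phi -> derive_le K' psi -> derive_le (K + K') (fun x => phi x + psi x).
Proof.
move=> Hf Hg fK gK x.
rewrite (derive1_eq (is_derive1D (smooth_is_derive Hf x) (smooth_is_derive Hg x))).
by rewrite (le_trans (ler_normD _ _))// lerD.
Qed.

Lemma derive_leZ K (a : R) phi : smooth phi -> derive_le K phi ->
  derive_le (`|a| * K) (fun x => a * phi x).
Proof.
move=> Hf fK x.
rewrite (derive1_eq (is_derive1M (is_derive_cst _ _ _) (smooth_is_derive Hf x))).
by rewrite mul0r add0r normrM ler_wpM2l.
Qed.

Lemma smooth_c_derive_le phi : smooth_c phi -> exists2 K, 0 <= K & derive_le K phi.
Proof. by move/smooth_c_derive1/smooth_c_bounded. Qed.

Lemma Binf_derive_le (e K : R) phi : smooth_c phi -> derive_le K phi -> K < e ->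
  Binf e phi.
Proof.
move=> Hf fK Ke; split; first exact: smooth_c_Cinf_c.
by rewrite (le_lt_trans (supnorm_le fK)).
Qed.

Lemma derive1_comp_affine phi (a b x : R) : smooth phi ->
  derive1 (fun x => phi (a * x + b)) x = derive1 phi (a * x + b) * a.
Proof.
move=> Hf; apply: derive1_eq.
exact: (is_derive1_cmp (smooth_is_derive Hf _) (is_derive1_affine a b x)).
Qed.

End derivative_bound.

(** The identity behind [L_mulX], isolated so that [ring] meets no embedded reals. There
    [h = s / 2], [ew] and [ea] are the values of [E (Id + s phi)] at [w] and of [E (Id + s eta)] at
    [z0], [X = L (x psi)], [Y = L (psi^2)], and [Lr], [LA], [Le] are [L] of [rho], [phi o A],
    [eta]. *)
Lemma expansion_cancellation (K : comPzRingType)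
    (s h sg tu z w ew ea X Y Lr Lphi LA Le : K) :
  w = sg * z + tu -> ew = sg * ea + tu -> sg * Le = LA -> s * Lr = LA - Lphi ->
  s ^+ 2 * X = s ^+ 2 * (Lr - h * Y) + (w - z) + sg * (ea - z - s * Le) -
    (ew - z - s * (Lphi + s * X + s * h * Y)).
Proof.
move=> -> -> sLe sLr.
have -> : s ^+ 2 * (Lr - h * Y) + (sg * z + tu - z) + sg * (ea - z - s * Le) -
    (sg * ea + tu - z - s * (Lphi + s * X + s * h * Y)) =
    s * (s * Lr) - s * (sg * Le) + s * Lphi + s ^+ 2 * X by ring.
by rewrite sLe sLr; ring.
Qed.

Section first_order_expansion.
Variables (R : realType) (E : (R -> R) -> R[i] -> R[i]).
Hypothesis E_half_plane : forall f z, BLip f -> upper_half_plane z ->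
  upper_half_plane (E f z).
Hypothesis E_affine : forall a b : R, 0 < a -> forall z, upper_half_plane z ->
  E (fun x : R => a * x + b) z = a%:C * z + b%:C.
Hypothesis E_comp : forall f g, BLip f -> BLip g ->
  forall z, upper_half_plane z -> E (f \o g) z = E f (E g z).
Hypothesis E_cont : forall (f_ : nat -> R -> R) (f : R -> R),
  (forall n, BLip (f_ n)) -> BLip f -> {family compact, f_ @ \oo --> f} ->
  forall z, upper_half_plane z ->
    (E (f_ n) z : R[i]^o) @[n --> \oo] --> (E f z : R[i]^o).
Variables (z0 : R[i]) (e0 : R) (L Rem : (R -> R) -> R[i]).
Hypothesis z0_half_plane : upper_half_plane z0.
Hypothesis e0_itv : 0 < e0 < 1.
Hypothesis L_linear : linear_functional_on (@Cinf_c R) L.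
Hypothesis E_expand : forall phi, Binf e0 phi ->
  E (fun x : R => x + phi x) z0 = z0 + L phi + Rem phi.
Hypothesis Rem_small : forall c : R, 0 < c ->
  exists2 e : R, 0 < e < e0 &
    forall phi, Binf e phi -> `|Rem phi| <= (c * supnorm (derive1 phi) ^+ 2)%:C.
Implicit Types (f g phi psi : R -> R) (x : R).

Lemma smooth_c0 : smooth_c (fun _ : R => 0 : R).
Proof. by constructor; [exact: smooth_cst|exists 0]. Qed.

Lemma L_comb (a : R) phi psi : smooth_c phi -> smooth_c psi ->
  L (fun x => a * phi x + psi x) = a%:C * L phi + L psi.
Proof. by move=> Hf Hg; apply: L_linear; exact: smooth_c_Cinf_c. Qed.

Lemma functional0 : L (fun=> 0) = 0.
Proof.
have := L_comb 1 smooth_c0 smooth_c0.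
under [X in L X = _ -> _]eq_fun do rewrite mulr0 addr0.
by rewrite mul1r => /eqP; rewrite -subr_eq0 opprD addrA subrr sub0r oppr_eq0 => /eqP.
Qed.

Lemma functionalZ (a : R) phi : smooth_c phi -> L (fun x => a * phi x) = a%:C * L phi.
Proof.
move=> Hf; have := L_comb a Hf smooth_c0.
by rewrite functional0 addr0; under [X in L X = _ -> _]eq_fun do rewrite addr0.
Qed.

Lemma functionalD phi psi : smooth_c phi -> smooth_c psi ->
  L (fun x => phi x + psi x) = L phi + L psi.
Proof.
move=> Hf Hg; have := L_comb 1 Hf Hg.
by rewrite mul1r; under [X in L X = _ -> _]eq_fun do rewrite mul1r.
Qed.

Lemma functionalN phi : smooth_c phi -> L (fun x => - phi x) = - L phi.
Proof.
move=> Hf; have := functionalZ (-1) Hf; rewrite rmorphN mulN1r => <-.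
by congr L; apply/funext => x; rewrite mulN1r.
Qed.

Lemma functionalB phi psi : smooth_c phi -> smooth_c psi ->
  L (fun x => phi x - psi x) = L phi - L psi.
Proof. by move=> Hf Hg; rewrite -(functionalN Hg) -functionalD//; exact: smooth_cN. Qed.

Lemma BLip_affine (a b : R) : 0 < a -> BLip (fun x => a * x + b).
Proof.
move=> a0; apply: (@BLip_of_derive _ _ (fun=> a) a a) => //.
  exact: is_derive1_affine.
by move=> x; rewrite lexx.
Qed.

Lemma BLip_id_add phi (K : R) : (forall x : R, derivable phi x 1) ->
  derive_le K phi -> K < 1 -> BLip (fun x => x + phi x).
Proof.
move=> Hf fK K1.
apply: (@BLip_of_derive _ _ (fun x => 1 + derive1 phi x) (1 - K) (1 + K)) => [|x|x].
- by rewrite subr_gt0.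
- by apply: is_derive1D; exact: derivable_is_derive1.
- by have := fK x; rewrite ler_norml => /andP[h1 h2]; apply/andP; split; lra.
Qed.

(** The range [t0] depends only on [c] and the derivative bound. This uniformity is essential in
    [L_mulX], where the functions expanded vary with the step [s] itself. *)
Lemma E_expansion (c K : R) : 0 < c -> 0 <= K ->
  exists2 t0 : R, 0 < t0 & forall t phi, 0 < t <= t0 -> smooth_c phi -> derive_le K phi ->
    BLip (fun x => x + t * phi x) /\
    modc (E (fun x => x + t * phi x) z0 - z0 - t%:C * L phi) <= c * t ^+ 2.
Proof.
move=> c0 K0; have K1 : 0 < K + 1 by lra.
(* The derivative of [t phi] is at most [t (K + 1)], so this constant turns the remainder into
   [c t^2]; [K + 1] is positive even when [K = 0]. *)
have [|e /andP[e_gt0 ee0] He] := Rem_small (c := c / (K + 1) ^+ 2).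
  by rewrite divr_gt0// exprn_gt0.
have [_ e01] := andP e0_itv.
exists (e / (K + 1)) => [|t phi /andP[t0 te] Hf fK]; first by rewrite divr_gt0.
have tK : t * (K + 1) <= e by rewrite -ler_pdivlMr.
have tK' : t * K < e by rewrite mulrDr in tK; lra.
have tfK : derive_le (t * K) (fun x => t * phi x).
  by rewrite -[t in t * K]gtr0_norm//; apply: derive_leZ => //; case: Hf.
have tf := smooth_cZ t Hf.
split.
  apply: (BLip_id_add (K := t * K)) => //; last lra.
  by move=> x; have := smooth_is_derive (smooth_c_smooth tf) x => -[].
rewrite E_expand; last by apply: (Binf_derive_le tf tfK); lra.
rewrite (functionalZ t Hf).
have -> r : z0 + t%:C * L phi + r - z0 - t%:C * L phi = r by ring.
rewrite -lecR -modcE (le_trans (He _ (Binf_derive_le tf tfK tK')))// lecR.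
have sup_le : supnorm (derive1 (fun x => t * phi x)) <= t * (K + 1).
  by rewrite (le_trans (supnorm_le tfK))// ler_wpM2l ?(ltW t0)//; lra.
rewrite mulrAC ler_pdivrMr ?exprn_gt0// -mulrA ler_wpM2l ?(ltW c0)// -exprMn.
by rewrite ler_pXn2r// nnegrE ?supnorm_ge0// mulr_ge0// ltW.
Qed.

(** [L phi] is the difference quotient [(E (Id + t phi) z0 - z0) / t] up to [O(t)]. First [t] is
    fixed from [K], [al] and [e]; then (P4) at the affine map [(1 + t al) x + t be] is used with
    accuracy [t e / 2]. *)
Lemma L_continuous (al be K e : R) : 0 < e ->
  exists N : nat, forall phi, smooth_c phi -> derive_le K phi ->
    (forall x, `|x| <= N%:R -> `|phi x - (al * x + be)| <= N.+1%:R^-1) ->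
    modc (L phi - (al%:C * z0 + be%:C)) <= e.
Proof.
move=> e_gt0.
have [K0|K0] := ltP K 0.
  by exists 0%N => phi _ /derive_le_ge0; rewrite leNgt K0.
have [t0 t0_gt0 Ht0] := E_expansion ltr01 K0.
have al1 : 0 < `|al| + 1 by rewrite ltr_wpDl.
(* The four bounds give the expansion, absorb its error [t^2] into [t e / 2], pass closeness from
   [phi] to [t phi], and keep [1 + t al] positive. *)
pose t := Num.min (Num.min t0 (e / 2)) (Num.min 1 ((2^-1) / (`|al| + 1))).
have t_gt0 : 0 < t.
  by rewrite !lt_min t0_gt0 ltr01 /= !divr_gt0//.
have tt0 : t <= t0 by rewrite !ge_min lexx.
have te : t <= e / 2 by rewrite !ge_min lexx ?orbT.
have t1 : t <= 1 by rewrite !ge_min lexx ?orbT.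
have tal : t * (`|al| + 1) <= 2^-1 by rewrite -ler_pdivlMr// !ge_min lexx ?orbT.
have sl : 0 < 1 + t * al.
  have : - (t * al) <= t * `|al|.
    by rewrite -mulrN ler_wpM2l ?(ltW t_gt0)// -normrN ler_norm.
  by rewrite mulrDr mulr1 in tal; lra.
have te2 : 0 < t * (e / 2) by rewrite mulr_gt0// divr_gt0.
have [N HN] := local_uniform_continuity E_cont (BLip_affine (t * be) sl) z0_half_plane te2.
exists N => phi Hf fK close.
have [|Bf Ef] := Ht0 t phi _ Hf fK; first by rewrite t_gt0 tt0.
have {HN} := HN _ Bf.
rewrite E_affine// => Hclose.
have {}Hclose : modc (E (fun x : R => x + t * phi x) z0 -
           ((1 + t * al)%:C * z0 + (t * be)%:C)) <= t * (e / 2).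
  apply: Hclose => x xN.
  have -> : x + t * phi x - ((1 + t * al) * x + t * be) = t * (phi x - (al * x + be)) by ring.
  rewrite normrM gtr0_norm//.
  have := close x xN; have : 0 <= `|phi x - (al * x + be)| by [].
  by move=> h1 h2; apply: (le_trans _ h2); rewrite ler_piMl.
set a := E _ z0 in Ef Hclose.
have : modc (t%:C * (L phi - (al%:C * z0 + be%:C))) <= t * e.
  have -> : t%:C * (L phi - (al%:C * z0 + be%:C)) =
     (a - ((1 + t * al)%:C * z0 + (t * be)%:C)) + - (a - z0 - t%:C * L phi).
    rewrite !rmorphD !rmorphM rmorph1; ring.
  apply: (le_trans (modcD _ _)); rewrite modcN.
  have : t * t <= t * (e / 2) by rewrite ler_wpM2l// ltW.
  rewrite expr2 in Ef; lra.
by rewrite modcM modc_real gtr0_norm// ler_pM2l.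
Qed.

(** Brings an evaluation back to [z0], the only point where the expansion is assumed. *)
Lemma E_at f (s t : R) : 0 < s -> BLip f ->
  upper_half_plane (s%:C * z0 + t%:C) ->
  E f (s%:C * z0 + t%:C) = E (fun x => f (s * x + t)) z0.
Proof.
move=> s0 Hf Hw.
by rewrite -(E_affine t s0)// -(E_comp Hf (BLip_affine t s0)).
Qed.

Lemma E_affine_comp f (s t : R) : 0 < s -> BLip f ->
  E (fun x => s * f x + t) z0 = s%:C * E f z0 + t%:C.
Proof.
move=> s0 Hf; rewrite -(E_affine t s0); last exact: E_half_plane.
by rewrite -(E_comp (BLip_affine t s0) Hf).
Qed.

(** Increasing affine maps act transitively on the half-plane; the last two clauses make the
    distance of this map to the identity proportional to that of [w] to [z0]. *)
Lemma half_plane_affine w : upper_half_plane w ->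
  exists s t : R, [/\ 0 < s, w = s%:C * z0 + t%:C,
    s - 1 = complex.Im (w - z0) / complex.Im z0 &
    t = complex.Re (w - z0) - (s - 1) * complex.Re z0].
Proof.
case: w => u v; rewrite /upper_half_plane/= => v0.
case: z0 z0_half_plane => x0 y0; rewrite /upper_half_plane/= => y0_gt0.
have yn : y0 != 0 by rewrite gt_eqF.
exists (v / y0), (u - v / y0 * x0); split.
- by rewrite divr_gt0.
- by apply/eqP; rewrite eq_complex/=; apply/andP; split; apply/eqP; field.
- by field.
- by field.
Qed.

(** Compare two expansions of [E ((Id + s phi) o (Id + s psi)) z0]. Expanded directly, it is
    [z0 + s L phi + s^2 L (x psi) + o(s^2)]. Evaluated as [E (Id + s phi) w] with [w = A z0] and
    [w - z0 = o(s^2)], it is [z0 + s L phi + o(s^2)]. *)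
Lemma L_mulX psi : smooth_c psi -> L psi = 0 -> L (fun x => x * psi x) = 0.
Proof.
move=> Hpsi Lpsi.
have [chi [chi_smooth _ chi1 chi0]] := exists_cutoff R.
have [B B0 psiB] := smooth_c_bounded Hpsi.
have [M M0 psiM] := smooth_c_support Hpsi.
(* For [|x| <= M] and [s <= 1] both [x] and [x + s psi x] stay in [[- A, A]], where [phi] is
   quadratic. *)
pose A := M + B + 1.
have A0 : 0 < A by rewrite /A; lra.
(* As [phi] is [x^2 / 2] near the support of [psi], [phi (x + s psi x)] is exactly
   [phi + s x psi + s^2 psi^2 / 2] for small [s]. *)
pose phi x := (2^-1 * (x * x)) * chi (A^-1 * x + 0).
have Hphi : smooth_c phi.
  constructor.
    apply: smoothM; last exact: smooth_comp_affine.
    exact: (smoothM (smooth_cst _) (smoothM smooth_id smooth_id)).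
  exists (2 * A) => [|x xA]; first by rewrite mulr_ge0// ltW.
  rewrite /phi chi0 ?mulr0// addr0 normrM gtr0_norm ?invr_gt0//.
  by rewrite mulrC ler_pdivlMr// ltW.
have phiE x : `|x| <= A -> phi x = 2^-1 * (x * x).
  move=> xA; rewrite /phi chi1 ?mulr1// addr0 normrM gtr0_norm ?invr_gt0//.
  by rewrite mulrC ler_pdivrMr// mul1r.
have Hxpsi : smooth_c (fun x => x * psi x) by exact: (smooth_cMl smooth_id Hpsi).
have Hpsi2 : smooth_c (fun x => psi x * psi x).
  exact: (smooth_cMl (smooth_c_smooth Hpsi) Hpsi).
pose om s x := psi x + phi x + (s * (x * psi x) + (s * s / 2) * (psi x * psi x)).
have Hom s : smooth_c (om s).
  apply: (smooth_cD (smooth_cD Hpsi Hphi)).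
  exact: (smooth_cD (smooth_cZ _ Hxpsi) (smooth_cZ _ Hpsi2)).
have LomE s : L (om s) = L phi + s%:C * L (fun x => x * psi x)
    + (s * s / 2)%:C * L (fun x => psi x * psi x).
  rewrite /om (functionalD (smooth_cD Hpsi Hphi) (smooth_cD (smooth_cZ _ Hxpsi) (smooth_cZ _ Hpsi2))).
  rewrite (functionalD Hpsi Hphi) (functionalD (smooth_cZ _ Hxpsi) (smooth_cZ _ Hpsi2)) Lpsi.
  by rewrite (functionalZ _ Hxpsi) (functionalZ _ Hpsi2) add0r addrA.
have [K1 K10 psiK] := smooth_c_derive_le Hpsi.
have [K2 K20 phiK] := smooth_c_derive_le Hphi.
have [K3 K30 xpsiK] := smooth_c_derive_le Hxpsi.
have [K4 K40 psi2K] := smooth_c_derive_le Hpsi2.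
(* One derivative bound for [psi], [phi] and every [om s] with [s <= 1], so that one [t0] serves all
   of them. *)
pose K := K1 + K2 + (K3 + K4).
have K0 : 0 <= K by rewrite !addr_ge0.
have psiK' : derive_le K psi by apply: derive_leW psiK; rewrite /K; lra.
have phiK' : derive_le K phi by apply: derive_leW phiK; rewrite /K; lra.
have omK s : 0 < s <= 1 -> derive_le K (om s).
  move=> /andP[s0 s1].
  have ss : s * s <= 1 by rewrite mulr_ile1// ltW.
  apply: derive_leD; [by apply: smoothD; [case: Hpsi|case: Hphi]| |
    by apply: derive_leD => //; [case: Hpsi|case: Hphi] |].
    by apply: smoothD; apply: smoothM; [exact: smooth_cst|case: Hxpsi|exact: smooth_cst|case:
      Hpsi2].
  apply: derive_leD.
  - by apply: smoothM; [exact: smooth_cst|case: Hxpsi].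
  - by apply: smoothM; [exact: smooth_cst|case: Hpsi2].
  - apply: (@derive_leW _ (`|s| * K3)); last by apply: derive_leZ => //; case: Hxpsi.
    by rewrite gtr0_norm// ler_piMl.
  - apply: (@derive_leW _ (`|s * s / 2| * K4)); last by apply: derive_leZ => //; case: Hpsi2.
    have ss0 : 0 < s * s by rewrite mulr_gt0.
    by rewrite ler_piMl// gtr0_norm ?divr_gt0//; lra.
have om_comp s : 0 < s <= 1 ->
    (fun x => x + s * phi x) \o (fun x => x + s * psi x) = (fun x => x + s * om s x).
  move=> /andP[s0 s1]; apply/funext => x /=; rewrite /om.
  have [xM|/psiM ->] := leP `|x| M; last by rewrite !(mulr0, addr0, add0r).
  have sB : `|s * psi x| <= B.
    by rewrite normrM gtr0_norm// (le_trans _ (psiB x))// ler_piMl.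
  rewrite !phiE; first by field.
    by rewrite /A; lra.
  by rewrite (le_trans (ler_normD _ _))// /A; lra.
have [C C0 HC] := smooth_c_affine_perturbation Hphi.
have [C' C'0 HC'] := smooth_c_affine_perturbation (smooth_c_derive1 Hphi).
apply: modc_small_eq => e e_gt0; rewrite subr0.
have y0_gt0 : 0 < complex.Im z0 := z0_half_plane.
set x0 := complex.Re z0; set y0 := complex.Im z0 in y0_gt0 *.
(* By [half_plane_affine], [|w - z0| <= s^2] gives [|sg - 1| + |tu| <= s^2 D]. *)
pose D := 1 + (1 + `|x0|) / y0.
have D0 : 0 < D by rewrite /D ltr_pwDl// divr_ge0 ?(ltW y0_gt0)// addr_ge0.
(* The expansion errors add up to [4 c s^2]: one [c s^2] from [w - z0], two from [eta] because
   [sg <= 2], one from [om s]. The bound [c <= 1] gives [|w - z0| <= s^2]. *)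
pose c := Num.min 1 (e / 16).
have c0 : 0 < c by rewrite lt_min ltr01/= divr_gt0.
have c1 : c <= 1 by rewrite ge_min lexx.
have ce : c <= e / 16 by rewrite ge_min lexx orbT.
have [t0 t0_gt0 Ht0] := E_expansion c0 K0.
pose K' := (K2 + C') * D.
have e8 : 0 < e / 8 by rewrite divr_gt0.
have [N HN] := L_continuous 0 0 K' e8.
pose P := modc (L (fun x => psi x * psi x)).
have P0 : 0 <= P := modc_ge0 _.
have N0 : 0 < N.+1%:R :> R by rewrite ltr0n.
have CD0 : 0 < C * D + 1 by rewrite ltr_wpDl// mulr_ge0// ltW.
have P10 : 0 < P + 1 by rewrite ltr_wpDl.
(* [s D <= 1/2] puts [sg] and [tu] in the range of [smooth_c_affine_perturbation]; the last two
   conditions make [rho] smaller than [1 / (N + 1)] and absorb the term in [psi^2]. *)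
have [s [s_gt0 st0 s1 sD]] : exists s, [/\ 0 < s, s <= t0, s <= 1,
    s * D <= 2^-1 & s * ((C * D + 1) * N.+1%:R) <= 1 /\ s * (P + 1) <= e / 4].
  exists (Num.min (Num.min t0 1) (Num.min (2^-1 / D) (Num.min (1 / ((C * D + 1) * N.+1%:R)) (e
    / 4 / (P + 1))))).
  rewrite -!ler_pdivlMr// ?mulr_gt0// !lt_min !ge_min !lexx !orbT t0_gt0/= ltr01.
  by rewrite !divr_gt0// ?mulr_gt0.
move=> [sN sP].
have s01 : 0 < s <= t0 by rewrite s_gt0.
have s11 : 0 < s <= 1 by rewrite s_gt0.
have [Bf _] := Ht0 s phi s01 Hphi phiK'.
have [Bg Eg] := Ht0 s psi s01 Hpsi psiK'.
have [_ Eom] := Ht0 s (om s) s01 (Hom s) (omK s s11).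
have Hw := E_half_plane Bg z0_half_plane.
rewrite -(om_comp s s11) (E_comp Bf Bg z0_half_plane) LomE in Eom.
set w := E (fun x => x + s * psi x) z0 in Eg Eom Hw.
rewrite Lpsi mulr0 subr0 in Eg.
have ss0 : 0 < s ^+ 2 by rewrite exprn_gt0.
have wz : modc (w - z0) <= s ^+ 2 by apply: (le_trans Eg); rewrite ler_piMl// ltW.
have [sg [tu [sg0 wE sgE tuE]]] := half_plane_affine Hw.
have sg_le : `|sg - 1| <= s ^+ 2 / y0.
  rewrite sgE normrM normfV (gtr0_norm y0_gt0) ler_wpM2r ?invr_ge0 ?(ltW y0_gt0)//.
  exact: le_trans (modc_Im _) wz.
have tu_le : `|tu| <= s ^+ 2 + s ^+ 2 / y0 * `|x0|.
  rewrite tuE (le_trans (ler_normB _ _))// lerD ?(le_trans (modc_Re _) wz)//.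
  by rewrite normrM ler_wpM2r.
have sgtu : `|sg - 1| + `|tu| <= s * (s * D).
  have -> : s * (s * D) = s ^+ 2 / y0 + (s ^+ 2 + s ^+ 2 / y0 * `|x0|).
    by rewrite /D; field; rewrite gt_eqF.
  exact: lerD.
have sgtu_s : `|sg - 1| + `|tu| <= s * D.
  by apply: (le_trans sgtu); rewrite ler_piMl// ?mulr_ge0// ltW.
have sg1 : `|sg - 1| <= 2^-1 by have := normr_ge0 tu; lra.
have tu1 : `|tu| <= 1 by have := normr_ge0 (sg - 1); lra.
have sgn : sg != 0 by rewrite gt_eqF.
have sg2 : sg <= 2 by have := ler_norm (sg - 1); lra.
pose phiA x := phi (sg * x + tu).
have HphiA : smooth_c phiA := smooth_c_comp_affine tu sgn Hphi.
have phiA_der x : derive1 phiA x = derive1 phi (sg * x + tu) * sg.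
  exact: derive1_comp_affine (smooth_c_smooth Hphi).
(* The conjugate of [Id + s phi] by the affine map [A] is [Id + s eta], and [eta' = phi' o A] keeps
   the derivative bound of [phi]. *)
pose eta x := sg^-1 * phiA x.
have Heta : smooth_c eta := smooth_cZ _ HphiA.
have etaK : derive_le K eta.
  move=> x.
  rewrite (derive1_eq (is_derive1M (is_derive_cst _ _ _) (smooth_is_derive (smooth_c_smooth
    HphiA) x))).
  by rewrite mul0r add0r phiA_der mulrCA mulVf// mulr1 phiK'.
have [Beta Eeta] := Ht0 s eta s01 Heta etaK.
have Efw : E (fun x => x + s * phi x) w = sg%:C * E (fun x => x + s * eta x) z0 + tu%:C.
  rewrite -(E_affine_comp tu sg0 Beta) wE E_at//; last by rewrite -wE.
  by congr (E _ z0); apply/funext => x; rewrite /eta /phiA; field.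
have Leta : L eta = sg^-1%:C * L phiA := functionalZ _ HphiA.
(* [A] is [s^2]-close to the identity, so [rho] is [O(s)] in [C^1]; by [L_continuous],
   [L (phi o A) - L phi = o(s)]. *)
pose rho x := s^-1 * (phiA x - phi x).
have Hrho : smooth_c rho := smooth_cZ _ (smooth_cB HphiA Hphi).
have Lrho : L rho = s^-1%:C * (L phiA - L phi).
  by rewrite (functionalZ _ (smooth_cB HphiA Hphi)) (functionalB HphiA Hphi).
have rhoK : derive_le K' rho.
  move=> x.
  rewrite (derive1_eq (is_derive1M (is_derive_cst _ _ _) (smooth_is_derive (smooth_c_smooth
    (smooth_cB HphiA Hphi)) x))).
  rewrite mul0r add0r (derive1_eq (is_derive1B (smooth_is_derive (smooth_c_smooth HphiA) x)
    (smooth_is_derive (smooth_c_smooth Hphi) x))).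
  rewrite phiA_der normrM normfV (gtr0_norm s_gt0) ler_pdivrMl//.
  have -> : derive1 phi (sg * x + tu) * sg - derive1 phi x =
     (sg - 1) * derive1 phi (sg * x + tu) + (derive1 phi (sg * x + tu) - derive1 phi x).
    by rewrite mulrBl mul1r mulrC addrA subrK.
  have h1 : `|(sg - 1) * derive1 phi (sg * x + tu)| <= s * D * K2.
    rewrite normrM ler_pM//.
    by apply: le_trans sgtu_s; rewrite lerDl.
  have h2 : `|derive1 phi (sg * x + tu) - derive1 phi x| <= s * D * C'.
    by rewrite (le_trans (HC' _ _ sg1 tu1 x))// mulrC ler_wpM2r.
  have := ler_normD ((sg - 1) * derive1 phi (sg * x + tu)) (derive1 phi (sg * x + tu) - derive1
    phi x).
  by rewrite /K'; lra.
have {HN} Lrho_le : modc (L rho) <= e / 8.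
  have := HN rho Hrho rhoK; rewrite mul0r addr0 subr0; apply => x _.
  rewrite mul0r addr0 subr0 /rho normrM normfV (gtr0_norm s_gt0) ler_pdivrMl//.
  rewrite (le_trans (HC _ _ sg1 tu1 x))// (le_trans (ler_wpM2l C0 sgtu))//.
  rewrite ler_pdivlMr//.
  have : s * (s * ((C * D + 1) * N.+1%:R)) <= s * 1 by rewrite ler_wpM2l// ltW.
  have : 0 <= s * (s * N.+1%:R) by rewrite !mulr_ge0// ltW.
  by lra.
have sLeta : sg%:C * L eta = L phiA.
  by rewrite Leta mulrA -rmorphM mulfV// mul1r.
have sLrho : s%:C * L rho = L phiA - L phi.
  by rewrite Lrho mulrA -rmorphM mulfV ?gt_eqF// mul1r.
have key : (s ^+ 2)%:C * L (fun x => x * psi x) =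
    (s ^+ 2)%:C * (L rho - (s / 2)%:C * L (fun x => psi x * psi x)) + (w - z0) +
    sg%:C * (E (fun x => x + s * eta x) z0 - z0 - s%:C * L eta) -
    (E (fun x => x + s * phi x) w - z0 - s%:C * (L phi + s%:C * L (fun x => x * psi x)
       + (s * s / 2)%:C * L (fun x => psi x * psi x))).
  have ss : (s * s / 2)%:C = s%:C * (s / 2)%:C by rewrite -rmorphM mulrA.
  have s2 : (s ^+ 2)%:C = s%:C ^+ 2 by rewrite -rmorphXn.
  rewrite ss s2.
  apply: (expansion_cancellation (K := R[i])); [exact: wE|exact: Efw|exact: sLeta|exact: sLrho].
have : modc ((s ^+ 2)%:C * L (fun x => x * psi x)) <= s ^+ 2 * (e / 2).
  rewrite key.
  apply: (le_trans (modcD _ _)); rewrite modcN.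
  have h1 := Eom.
  have h2 : modc (sg%:C * (E (fun x => x + s * eta x) z0 - z0 - s%:C * L eta)) <= 2 * (c * s ^+
    2).
    by rewrite modcM modc_real (gtr0_norm sg0) ler_pM// ?modc_ge0// ltW.
  have h3 : modc ((s ^+ 2)%:C * (L rho - (s / 2)%:C * L (fun x => psi x * psi x))) <= s ^+ 2 *
    (e / 4).
    rewrite modcM modc_real (gtr0_norm ss0) ler_wpM2l ?(ltW ss0)//.
    rewrite (le_trans (modcD _ _))// modcN modcM modc_real gtr0_norm ?divr_gt0// -/P.
    by rewrite mulrDr mulr1 in sP; lra.
  have h4 := modcD ((s ^+ 2)%:C * (L rho - (s / 2)%:C * L (fun x => psi x * psi x)) + (w - z0))
    (sg%:C * (E (fun x => x + s * eta x) z0 - z0 - s%:C * L eta)).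
  have h5 := modcD ((s ^+ 2)%:C * (L rho - (s / 2)%:C * L (fun x => psi x * psi x))) (w - z0).
  have h6 : s ^+ 2 * c <= s ^+ 2 * (e / 16) by rewrite ler_wpM2l// ltW.
  by lra.
by rewrite modcM modc_real (gtr0_norm ss0) ler_pM2l//; lra.
Qed.

End first_order_expansion.

(** * The two base points *)

Section two_points.
Variables (R : realType) (z0 : R[i]) (L : (R -> R) -> R[i]).
Hypothesis z0_half_plane : upper_half_plane z0.
Implicit Types (f g phi psi : R -> R) (x : R).
Hypothesis LZ : forall (a : R) phi, smooth_c phi ->
  L (fun x => a * phi x) = a%:C * L phi.
Hypothesis LD : forall phi psi, smooth_c phi -> smooth_c psi ->
  L (fun x => phi x + psi x) = L phi + L psi.
Hypothesis L_continuous : forall al be K e : R, 0 < e ->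
  exists N : nat, forall phi, smooth_c phi -> derive_le K phi ->
    (forall x, `|x| <= N%:R -> `|phi x - (al * x + be)| <= N.+1%:R^-1) ->
    modc (L phi - (al%:C * z0 + be%:C)) <= e.
Hypothesis L_mulX : forall psi, smooth_c psi -> L psi = 0 -> L (fun x => x * psi x) = 0.

Variable chi : R -> R.
Hypothesis chi_smooth : smooth chi.
Hypothesis chi01 : forall x, 0 <= chi x <= 1.
Hypothesis chi1 : forall x, `|x| <= 1 -> chi x = 1.
Hypothesis chi0 : forall x, 2 <= `|x| -> chi x = 0.

Lemma chi_smooth_c : smooth_c chi.
Proof. by constructor => //; exists 2 => // x /ltW; exact: chi0. Qed.

(** The [+ 0] keeps the literal shape [a * x + b] expected by the lemmas on affine substitution. *)
Definition cut (A : R) x := chi (A^-1 * x + 0).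

Lemma cut_smooth_c A : 0 < A -> smooth_c (cut A).
Proof. by move=> A0; apply: smooth_c_comp_affine chi_smooth_c; rewrite invr_eq0 gt_eqF. Qed.

Lemma cut1 A x : 0 < A -> `|x| <= A -> cut A x = 1.
Proof.
move=> A0 xA; rewrite /cut chi1// addr0 normrM gtr0_norm ?invr_gt0//.
by rewrite mulrC ler_pdivrMr// mul1r.
Qed.

Lemma cut_affine_smooth_c A al be : 0 < A -> smooth_c (fun x => (al * x + be) * cut A x).
Proof. by move=> A0; apply: (smooth_cMl (smooth_affine al be)); exact: cut_smooth_c. Qed.

(** With [u = x / A] the derivative is [al chi u + al u chi' u + be chi' u / A]: the growth of [x]
    is compensated by the factor [1 / A] coming from the cutoff. *)
Lemma cut_affine_derive_le al be : exists K, forall A, 1 <= A ->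
  derive_le K (fun x => (al * x + be) * cut A x).
Proof.
have [B1 B10 HB1] := smooth_c_bounded (smooth_c_derive1 chi_smooth_c).
have [B2 B20 HB2] := smooth_c_bounded (smooth_cMl smooth_id (smooth_c_derive1 chi_smooth_c)).
exists (`|al| + (`|al| * B2 + `|be| * B1)) => A A1 x.
have A0 : 0 < A by lra.
rewrite (derive1_eq (is_derive1M (is_derive1_affine al be x) (smooth_is_derive (smooth_c_smooth
  (cut_smooth_c A0)) x))).
rewrite (derive1_comp_affine _ _ _ chi_smooth).
set u := A^-1 * x + 0; have uE : x = A * u by rewrite /u addr0 mulVKf// gt_eqF.
have -> : al * cut A x + (al * x + be) * (derive1 chi u * A^-1) =
    al * chi u + (al * (u * derive1 chi u) + be * derive1 chi u * A^-1).
  by rewrite /cut -/u [in al * x]uE; field; rewrite gt_eqF.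
rewrite (le_trans (ler_normD _ _))// lerD//.
  rewrite normrM ler_piMr// ger0_norm; have /andP[]// := chi01 u.
rewrite (le_trans (ler_normD _ _))// lerD//.
  by rewrite normrM ler_wpM2l// HB2.
rewrite !normrM normfV (gtr0_norm A0) ler_pdivrMr//.
have : `|be| * `|derive1 chi u| <= `|be| * B1 by rewrite ler_wpM2l.
by move/le_trans; apply; rewrite ler_peMr// mulr_ge0.
Qed.

Lemma L_affine_cut al be e : 0 < e -> exists2 A0, 1 <= A0 & forall A, A0 <= A ->
  modc (L (fun x => (al * x + be) * cut A x) - (al%:C * z0 + be%:C)) <= e.
Proof.
move=> e0; have [K HK] := cut_affine_derive_le al be.
have [N HN] := L_continuous al be K e0.
exists (N%:R + 1) => [|A NA]; first by rewrite lerDr.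
have N0 : 0 <= N%:R :> R by [].
have A0 : 0 < A by lra.
apply: HN => [| |x xN].
- exact: cut_affine_smooth_c.
- by apply: HK; lra.
- by rewrite cut1 ?mulr1 ?subrr ?normr0// ?invr_ge0//; lra.
Qed.

Lemma LB phi psi : smooth_c phi -> smooth_c psi ->
  L (fun x => phi x - psi x) = L phi - L psi.
Proof.
move=> Hf Hg; have := LZ (-1) Hg; rewrite rmorphN mulN1r => <-.
rewrite -(LD Hf (smooth_cZ _ Hg)); congr L; apply/funext => x.
by rewrite mulN1r.
Qed.

(** The numbers [1] and [z0] form a real basis of the complex plane, and so do all pairs close
    enough to them, such as the values of [L] on wide cutoffs of [1] and [x]. *)
Lemma L_cyclic : exists psi, smooth_c psi /\
  forall w, exists u v : R, w = u%:C * L psi + v%:C * L (fun x => x * psi x).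
Proof.
have y0_gt0 : 0 < complex.Im z0 := z0_half_plane.
set x0 := complex.Re z0; set y0 := complex.Im z0 in y0_gt0 *.
have Q0 : 0 < 1 + y0 + `|x0| by rewrite ltr_wpDr//; lra.
(* The determinant differs from [y0] by at most [e (1 + y0 + |x0|) + 2 e^2], which is less than [y0]
   because [e < 1/2] and [e <= y0 / 2]. *)
pose e := y0 / 2 / (1 + y0 + `|x0|).
have e_gt0 : 0 < e by rewrite /e !divr_gt0.
have eQ : e * (1 + y0 + `|x0|) = y0 / 2 by rewrite /e divfK// gt_eqF.
have [A1 A11 HA1] := L_affine_cut 0 1 e_gt0.
have [A2 A21 HA2] := L_affine_cut 1 0 e_gt0.
pose A := A1 + A2; have A0 : 0 < A by rewrite /A; lra.
have HA1' := HA1 A _; have HA2' := HA2 A _.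
exists (cut A); split; first exact: cut_smooth_c.
have c1 : (fun x => (0 * x + 1) * cut A x) = cut A.
  by apply/funext => x; rewrite mul0r add0r mul1r.
have c2 : (fun x => (1 * x + 0) * cut A x) = (fun x => x * cut A x).
  by apply/funext => x; rewrite addr0 mul1r.
have {HA1'} h1 : modc (L (cut A) - 1) <= e.
  by rewrite -[X in L X]c1; have := HA1'; rewrite mul0r add0r; apply; rewrite /A; lra.
have {HA2'} h2 : modc (L (fun x => x * cut A x) - z0) <= e.
  by rewrite -[X in L X]c2; have := HA2'; rewrite mul1r addr0; apply; rewrite /A; lra.
move: h1 h2; move: (L (cut A)) (L (fun x => x * cut A x)) => [a b] [c d] h1 h2.
have := le_trans (modc_Re _) h1; have := le_trans (modc_Im _) h1.
have := le_trans (modc_Re _) h2; have := le_trans (modc_Im _) h2.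
rewrite !raddfB/= -/x0 -/y0 subr0 !ler_norml => /andP[d1 d2] /andP[c1' c2'] /andP[b1 b2]
  /andP[a1 a2].
have det0 : 0 < a * d - b * c.
  have bnd u v r : `|u| <= e -> `|v| <= r -> - (e * r) <= u * v.
    by move=> ue vr; rewrite lerNl (le_trans (ler_norm _))// normrN normrM ler_pM.
  have ha : `|a - 1| <= e by rewrite ler_norml a1.
  have hd : `|d - y0| <= e by rewrite ler_norml d1.
  have hb : `|- b| <= e by rewrite normrN ler_norml b1.
  have hc : `|c - x0| <= e by rewrite ler_norml c1'.
  have t1 := bnd _ _ _ ha hd; have t2 := bnd _ _ _ hb hc.
  have t3 : - (e * y0) <= (a - 1) * y0 by apply: bnd => //; rewrite gtr0_norm.
  have t4 := bnd _ _ _ hb (lexx `|x0|).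
  have ex0 : 0 <= e * `|x0| by rewrite mulr_ge0// ltW.
  have ey0 : 0 < e * y0 by rewrite mulr_gt0.
  have ee : e * e < 2^-1 * (y0 / 2).
    apply: ltr_pM; rewrite ?(ltW e_gt0)//; last by rewrite !mulrDr in eQ; lra.
    rewrite -(ltr_pM2r Q0) eQ; have := normr_ge0 x0; lra.
  have -> : a * d - b * c = y0 + (d - y0) + (a - 1) * y0 + (a - 1) * (d - y0)
      + - b * x0 + - b * (c - x0) by ring.
  rewrite !mulrDr in eQ; lra.
have det_neq : a * d - b * c != 0 by rewrite gt_eqF.
move=> [w1 w2].
exists ((w1 * d - w2 * c) / (a * d - b * c)), ((w2 * a - w1 * b) / (a * d - b * c)).
by apply/eqP; rewrite eq_complex/=; apply/andP; split; apply/eqP; field.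
Qed.

(** Modulo the kernel of [L], multiplication by [x] acts on a real plane with cyclic vector [psi].
    The relation expressing [x^2 psi] by [psi] and [x psi] yields [P] killing [psi], hence
    everything, as [P] commutes with [x]. *)
Lemma L_annihilating_quadratic : exists s d : R, forall psi, smooth_c psi ->
  L (fun x => (x * x - s * x + d) * psi x) = 0.
Proof.
have [psi [Hpsi span]] := L_cyclic.
have HX phi : smooth_c phi -> smooth_c (fun x => x * phi x) by exact: smooth_cMl smooth_id.
have [d [s sd]] := span (L (fun x => x * (x * psi x))).
exists s, (- d) => phi Hphi.
pose P x := x * x - s * x + - d.
have HP : smooth P.
  by apply: smoothD (smooth_cst _); apply: smoothB (smoothM smooth_id smooth_id) (smoothM
    (smooth_cst _) smooth_id).
have LP g : smooth_c g -> L (fun x => P x * g x) =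
    L (fun x => x * (x * g x)) - s%:C * L (fun x => x * g x) - d%:C * L g.
  move=> Hg; rewrite -(LZ d Hg) -(LZ s (HX _ Hg)).
  rewrite -(LB (HX _ (HX _ Hg)) (smooth_cZ s (HX _ Hg))).
  rewrite -(LB (smooth_cB (HX _ (HX _ Hg)) (smooth_cZ s (HX _ Hg))) (smooth_cZ d Hg)).
  by congr L; apply/funext => x; rewrite /P; ring.
have LPker g : smooth_c g -> L g = 0 -> L (fun x => P x * g x) = 0.
  move=> Hg Lg; have Lxg := L_mulX Hg Lg; rewrite (LP g Hg) Lg Lxg (L_mulX (HX _ Hg) Lxg).
  by rewrite !mulr0 !subr0.
have LPpsi : L (fun x => P x * psi x) = 0.
  by rewrite (LP psi Hpsi) sd; ring.
have [u [v uv]] := span (L phi).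
pose nu x := phi x - (u * psi x + v * (x * psi x)).
have Huv := smooth_cD (smooth_cZ u Hpsi) (smooth_cZ v (HX _ Hpsi)).
have Hnu : smooth_c nu := smooth_cB Hphi Huv.
have Lnu : L nu = 0.
  rewrite /nu (LB Hphi Huv) (LD (smooth_cZ u Hpsi) (smooth_cZ v (HX _ Hpsi))).
  by rewrite (LZ u Hpsi) (LZ v (HX _ Hpsi)) uv subrr.
have HPpsi : smooth_c (fun x => P x * psi x) by exact: smooth_cMl.
have -> : (fun x => (x * x - s * x + - d) * phi x) =
    (fun x => P x * nu x + (u * (P x * psi x) + v * (x * (P x * psi x)))).
  by apply/funext => x; rewrite /nu /P; ring.
rewrite (LD (smooth_cMl HP Hnu) (smooth_cD (smooth_cZ u HPpsi) (smooth_cZ v (HX _ HPpsi)))).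
rewrite (LD (smooth_cZ u HPpsi) (smooth_cZ v (HX _ HPpsi))).
rewrite (LZ u HPpsi) (LZ v (HX _ HPpsi)) (LPker _ Hnu Lnu) LPpsi (L_mulX HPpsi LPpsi).
by rewrite !mulr0 !addr0.
Qed.

(** Truncation is by the size of [phi], not by position. With [u = D phi], the derivative of [zeta]
    is [phi' (chi u + u chi' u)], bounded independently of [D], so [L_continuous] at the zero
    function applies. The order of the zeros of [P] thus does not matter. *)
Lemma L_vanishing P phi : smooth P -> (forall psi, smooth_c psi -> L (fun x => P x * psi x) =
  0) ->
  smooth_c phi -> (forall x, P x = 0 -> phi x = 0) -> L phi = 0.
Proof.
move=> HP LP Hphi P_phi; apply: modc_small_eq => e e0; rewrite subr0.
have [K K0 phiK] := smooth_c_derive_le Hphi.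
have [B B0 HB] := smooth_c_bounded (smooth_cMl smooth_id (smooth_c_derive1 chi_smooth_c)).
have [N HN] := L_continuous 0 0 (K * (1 + B)) e0.
(* [chi (D phi)] is nonzero only where [|phi| < 2 / D = 1 / (N + 1)]. *)
pose D : R := 2 * N.+1%:R.
have D0 : 0 < D by rewrite mulr_gt0.
have Hphis := smooth_c_smooth Hphi.
have Hc (a : R) : smooth (fun x => chi (a * phi x)).
  exact: (smooth_comp chi_smooth (smoothM (smooth_cst a) Hphis)).
(* [phi] is split by its size: [zeta] is uniformly small, and the rest is divisible
   by [P] since it vanishes near the zeros of [P]. *)
pose zeta x := chi (D * phi x) * phi x.
have Hzeta : smooth_c zeta by exact: smooth_cMl.
(* A smooth positive replacement for [P^2]: at a zero of [P] the second term is 1, and it vanishes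
   where [|D phi| >= 1], which includes every point where [1 - chi (D phi)] is nonzero. *)
pose Q x := P x * P x + chi (2 * D * phi x).
have Q0 x : 0 < Q x.
  have /andP[c0 _] := chi01 (2 * D * phi x).
  have [P0|P0] := eqVneq (P x) 0.
    by rewrite /Q P0 (P_phi _ P0) !mulr0 add0r chi1 ?normr0.
  by rewrite /Q ltr_pwDl// -expr2 exprn_even_gt0.
have HQ : smooth Q by apply: smoothD => //; exact: smoothM.
pose psi x := (P x * (Q x)^-1 * (1 - chi (D * phi x))) * phi x.
have Hpsi : smooth_c psi.
  apply: smooth_cMl Hphi; apply: smoothM; last exact: smoothB (smooth_cst _) (Hc _).
  by apply: smoothM => //; apply: smoothV => // x; rewrite gt_eqF.
have phiE : phi = (fun x => zeta x + P x * psi x).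
  apply/funext => x; rewrite /zeta /psi.
  have [D1|D1] := leP (`|D * phi x|) 1.
    by rewrite chi1// subrr !(mul1r, mulr0, mul0r, addr0).
  have : Q x = P x * P x.
    rewrite /Q chi0 ?addr0// -mulrA normrM (@ger0_norm _ 2)//; lra.
  have := Q0 x; move=> + QE; rewrite QE => PP0.
  have Pn : P x != 0 by apply: contraTneq PP0 => ->; rewrite mul0r ltxx.
  by field.
rewrite phiE (LD Hzeta (smooth_cMl HP Hpsi)) (LP _ Hpsi) addr0.
have := HN zeta Hzeta; rewrite mul0r addr0 subr0; apply.
- move=> x.
  have dc : is_derive x 1 (fun y => chi (D * phi y)) (derive1 chi (D * phi x) * (D * derive1
    phi x)).
    apply: is_derive1_cmp; first exact: smooth_is_derive.
    apply: (is_derive_eq (is_derive1M (is_derive_cst _ _ _) (smooth_is_derive Hphis x))).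
    by rewrite mul0r add0r.
  rewrite (derive1_eq (is_derive1M dc (smooth_is_derive Hphis x))).
  have -> : derive1 chi (D * phi x) * (D * derive1 phi x) * phi x + chi (D * phi x) * derive1
    phi x =
    derive1 phi x * (chi (D * phi x) + (D * phi x) * derive1 chi (D * phi x)).
    ring.
  rewrite normrM ler_pM// (le_trans (ler_normD _ _))// lerD//.
  by have /andP[h1 h2] := chi01 (D * phi x); rewrite ger0_norm.
- move=> x _; rewrite mul0r addr0 subr0 /zeta.
  have [D1|D1] := leP 2 (`|D * phi x|); first by rewrite chi0// mul0r normr0 invr_ge0.
  rewrite normrM (le_trans (y := `|phi x|))//.
    have /andP[h1 h2] := chi01 (D * phi x).
    by rewrite ger0_norm// ler_piMl.
  rewrite -[leRHS]mul1r ler_pdivlMr// mulrC.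
  by move: D1; rewrite normrM gtr0_norm// /D -mulrA => D1; lra.
Qed.

Theorem L_two_points : exists p q : R, q < p /\ forall phi, smooth_c phi ->
  L phi = ((phi p - phi q) / (p - q))%:C * z0 + (phi p - (phi p - phi q) / (p - q) * p)%:C.
Proof.
have y0_gt0 : 0 < complex.Im z0 := z0_half_plane.
have [s [d LP]] := L_annihilating_quadratic.
pose P x := x * x - s * x + d.
have HP : smooth P.
  by apply: smoothD (smooth_cst _); apply: smoothB (smoothM smooth_id smooth_id) (smoothM
    (smooth_cst _) smooth_id).
have van phi := @L_vanishing P phi HP LP.
have approx0 al be : al%:C * z0 + be%:C != 0 -> ~ (forall A, 1 <= A -> L (fun x => (al * x +
  be) * cut A x) = 0).
  move=> /eqP nz H; apply: nz; apply: modc_small_eq => e e0.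
  have [A A1 /(_ _ (lexx _))] := L_affine_cut al be e0.
  by rewrite H// modcB.
have [[p Pp]|noroot] := pselect (exists p, P p = 0); last first.
  exfalso; apply: (@approx0 0 1); first by rewrite mul0r add0r oner_neq0.
  move=> A A1; apply: van; first by apply: cut_affine_smooth_c; lra.
  by move=> x Px; exfalso; apply: noroot; exists x.
pose q := s - p.
have PE x : P x = (x - p) * (x - q).
  have : P x - P p = (x - p) * (x - q) by rewrite /P /q; ring.
  by rewrite Pp subr0.
have [pq|pq] := eqVneq p q.
  exfalso; apply: (@approx0 1 (- p)).
    apply/eqP => /(congr1 (@complex.Im R)).
    by rewrite raddfD/= mul1r addr0 => y00; rewrite y00 ltxx in y0_gt0.
  move=> A A1; apply: van; first by apply: cut_affine_smooth_c; lra.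
  move=> x; rewrite PE -pq => /eqP; rewrite mulf_eq0 orbb mul1r => /eqP ->.
  by rewrite mul0r.
have Lpq phi : smooth_c phi ->
  L phi = ((phi p - phi q) / (p - q))%:C * z0 + (phi p - (phi p - phi q) / (p - q) * p)%:C.
  move=> Hphi; set m := _ / (p - q); apply: modc_small_eq => e e0.
  (* The cutoff must equal 1 at both [p] and [q], so that [phi] minus the cut interpolant vanishes
     at the zeros of [P]. *)
  have [A0 A01 /(_ (A0 + `|p| + `|q|)) HA] := L_affine_cut m (phi p - m * p) e0.
  have p0 := normr_ge0 p; have q0 := normr_ge0 q.
  have {}HA := HA ltac:(lra); set A := A0 + _ + _ in HA.
  have A0' : 0 < A by rewrite /A; lra.
  have Hcut := cut_affine_smooth_c m (phi p - m * p) A0'.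
  suff -> : L phi = L (fun x => (m * x + (phi p - m * p)) * cut A x) by [].
  apply/eqP; rewrite -subr_eq0 -(LB Hphi Hcut); apply/eqP.
  apply: van; first exact: smooth_cB.
  have pqn : p - q != 0 by rewrite subr_eq0.
  move=> x; rewrite PE => /eqP; rewrite mulf_eq0 !subr_eq0 => /orP[] /eqP ->.
    by rewrite cut1//; [ring|rewrite /A; lra].
  by rewrite cut1//; [rewrite /m; field|rewrite /A; lra].
have [lt|le] := ltP q p; first by exists p, q.
have lt : p < q by rewrite lt_neqAle pq.
exists q, p; split => // phi Hphi; rewrite Lpq//.
have n1 : p - q != 0 by rewrite subr_eq0.
have n2 : q - p != 0 by rewrite subr_eq0 eq_sym.
have -> : (phi q - phi p) / (q - p) = (phi p - phi q) / (p - q).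
  by field; rewrite n1.
by congr (_ + _%:C); field.
Qed.

End two_points.

(** * Density of smooth functions *)

Section smooth_density.
Variable R : realType.
Implicit Types (f g h phi psi : R -> R) (x : R).

Lemma continuous_dist_lt h x e : continuous h -> 0 < e ->
  exists2 d : R, 0 < d & forall y, `|y - x| < d -> `|h y - h x| <= e.
Proof.
move=> ch e0; have /cvgrPdist_le/(_ _ e0)/nbhs_ballP[d /= d0 Hd] := ch x.
by exists d => // y yx; rewrite distrC; apply: Hd; rewrite /ball/= distrC.
Qed.

(** Let [c] be the supremum of the endpoints up to which a smooth approximation exists. Gluing
    extends an approximation up to [c + d / 2], which contradicts the choice of [c] unless [b] has
    been passed. *)
Lemma smooth_approx_segment h (a b e : R) : continuous h -> a <= b -> 0 < e ->
  exists2 H, smooth H & forall x, a <= x <= b -> `|H x - h x| <= e.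
Proof.
move=> ch ab e0.
have [s [Cs s01 s0 s1]] := exists_smooth_step R.
pose good t := exists2 H, smooth H & forall x, a <= x <= t -> `|H x - h x| <= e.
pose S := [set t | a <= t <= b /\ good t].
have Sa : S a.
  split; first by rewrite lexx.
  exists (fun=> h a); first exact: smooth_cst.
  by move=> x; rewrite -eq_le => /eqP <-; rewrite subrr normr0 ltW.
have supS : has_sup S by split; [exists a|exists b => t [/andP[]]].
set c := sup S.
have ac : a <= c by apply: sup_upper_bound.
have cb : c <= b by apply: ge_sup; [exists a|move=> t [/andP[]]].
have [d d0 Hd] := continuous_dist_lt c ch e0.
have [t [/andP[t1 t2] [H CH HH]] ct] := sup_adherent d0 supS.
have tc : t <= c by apply: sup_upper_bound => //; split; [rewrite t1|exists H].
rewrite -/c in ct.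
(* As [c - d < r < t], on [[r, t]] both [H] and the constant [h c] approximate [h], and so does any
   convex combination of them. *)
pose r := (c - d + t) / 2.
have tr : 0 < t - r by rewrite /r; lra.
(* An approximation on [[a, t]], [t < c], is glued by a smooth step to the constant
   [h c], which is a good approximation near [c]. *)
pose G x := H x + (h c - H x) * s ((t - r)^-1 * x + - (r / (t - r))).
have CG : smooth G.
  by apply: smoothD => //; apply: smoothM; [exact: smoothB (smooth_cst _) _|exact:
    smooth_comp_affine].
have Gd x : a <= x -> x < c + d -> `|G x - h x| <= e.
  move=> ax xd; rewrite /G.
  have -> : (t - r)^-1 * x + - (r / (t - r)) = (x - r) / (t - r) by ring.
  have [xr|rx] := leP x r.
    rewrite s0 ?mulr0 ?addr0; first by apply: HH; rewrite ax /= ; move: xr; rewrite /r; lra.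
    by rewrite pmulr_lle0 ?invr_gt0//; lra.
  have hc : `|h c - h x| <= e by rewrite distrC; apply: Hd; rewrite ltr_norml; move: rx;
    rewrite /r; lra.
  have [tx|xt] := leP t x.
    rewrite s1 ?mulr1; first by rewrite [H x + _]addrC subrK.
    by rewrite ler_pdivlMr//; lra.
  have Hx : `|H x - h x| <= e by apply: HH; rewrite ax /= ltW.
  have /andP[] := s01 ((x - r) / (t - r)); set u := s _ => u0 u1.
  have -> : H x + (h c - H x) * u - h x = (1 - u) * (H x - h x) + u * (h c - h x) by ring.
  have v0 : 0 <= 1 - u by lra.
  rewrite (le_trans (ler_normD _ _))// !normrM (ger0_norm u0) (ger0_norm v0).
  have := ler_wpM2l u0 hc; have := ler_wpM2l v0 Hx; lra.
have [cdb|bcd] := leP (c + d / 2) b.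
  have : S (c + d / 2).
    split; first by apply/andP; split; lra.
    by exists G => // x /andP[h1 h2]; apply: Gd => //; lra.
  by move/(sup_upper_bound supS); rewrite -/c; lra.
by exists G => // x /andP[h1 h2]; apply: Gd => //; lra.
Qed.

(** Integration starts at [a - 1]: the fundamental theorem covers every [x >= a], and the integral
    is identically 0 to the left of [a]. *)
Lemma continuous_antiderivative h (a : R) : continuous h ->
  (forall x, x <= a -> h x = 0) -> exists F : R -> R, forall x : R, is_derive x 1 F (h x).
Proof.
move=> ch h0.
pose F x := (\int[lebesgue_measure]_(t in `[(a - 1)%R, x]) h t)%R.
exists F => x; have [xa|ax] := ltP x a.
  rewrite h0 ?ltW//; apply: (@near_eq_is_derive _ _ _ (fun=> 0)).
  near=> y; rewrite /F.
  have ya : y < a by near: y; exact: lt_nbhsl.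
  rewrite (@eq_Rintegral _ _ _ _ _ (fun=> 0)).
    by rewrite Rintegral_cst ?mul0r//; exact: measurable_itv.
  move=> t; rewrite inE/= in_itv/= => /andP[_ ty].
  by rewrite h0// (le_trans ty)// ltW.
have x1 : x < x + 1 by lra.
have ax1 : a - 1 < x by lra.
have int : lebesgue_measure.-integrable `[(a - 1)%R, (x + 1)%R] (EFin \o h).
  apply: continuous_compact_integrable; first exact: segment_compact.
  exact: continuous_subspaceT.
have [dF dFE] := continuous_FTC1_closed x1 int ax1 (ch x).
by rewrite -dFE; exact: derivable_is_derive1.
Unshelve. all: by end_near.
Qed.

Variable chi : R -> R.
Hypothesis chi_smooth : smooth chi.
Hypothesis chi01 : forall x, 0 <= chi x <= 1.
Hypothesis chi1 : forall x, `|x| <= 1 -> chi x = 1.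
Hypothesis chi0 : forall x, 2 <= `|x| -> chi x = 0.

Lemma cut_support A x : 0 < A -> 2 * A <= `|x| -> cut chi A x = 0.
Proof.
move=> A0 xA; rewrite /cut chi0// addr0 normrM gtr0_norm ?invr_gt0//.
by rewrite mulrC ler_pdivlMr.
Qed.

(** The derivative is approximated first and then integrated from [- A], where [g] vanishes. Since
    [g] is unchanged by the cutoff at [A], cutting the primitive [F] as well restores compact
    support. *)
Lemma smooth_c_approx_C1 g (dg : R -> R) (M e : R) :
  (forall x : R, is_derive x 1 g (dg x)) -> continuous dg ->
  (forall x, M < `|x| -> g x = 0) -> 0 < e ->
  exists psi, [/\ smooth_c psi, forall x, `|g x - psi x| <= e &
    forall x, `|dg x - derive1 psi x| <= e].
Proof.
move=> gdg cdg gM e0.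
have [B B0 HB] := smooth_c_bounded (smooth_c_derive1 (chi_smooth_c chi_smooth chi0)).
pose A : R := `|M| + 1.
have A0 : 0 < A by rewrite ltr_wpDl.
have MA : M < A by rewrite (le_lt_trans (ler_norm M))// ltrDl.
have cutA := cut_smooth_c chi_smooth chi0 A0.
have Q0 : 0 < 1 + 3 * A * (1 + B / A).
  by rewrite ltr_pwDl// mulr_ge0 ?mulr_ge0 ?addr_ge0 ?divr_ge0 ?(ltW A0).
(* Points of [[- 2 A, 2 A]] are within [3 A] of [- A], so [|F - g| <= 3 A d]; the derivative of the
   cutoff multiplies this by at most [B / A]. *)
pose d := e / (1 + 3 * A * (1 + B / A)).
have d0 : 0 < d by rewrite divr_gt0.
have dE : d * (1 + 3 * A * (1 + B / A)) = e by rewrite divfK// gt_eqF.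
have BA0 : 0 <= B / A by rewrite divr_ge0// ltW.
have AA : - (2 * A) <= 2 * A by rewrite ge0_cp// mulr_ge0// ltW.
have [H CH HH] := smooth_approx_segment cdg AA d0.
have A20 : 0 < 2 * A by rewrite mulr_gt0.
pose H1 x := H x * cut chi (2 * A) x.
have CH1 : smooth_c H1 := smooth_cMl CH (cut_smooth_c chi_smooth chi0 A20).
have H1E x : `|x| <= 2 * A -> H1 x = H x.
  by move=> xA; rewrite /H1 (cut1 chi1)// mulr1.
have H1_0 x : x <= - (2 * (2 * A)) -> H1 x = 0.
  move=> xA; rewrite /H1 cut_support ?mulr0// ler_normr; apply/orP; right; lra.
have [F0 F0der] := continuous_antiderivative
  (is_derive1_continuous (smooth_is_derive (smooth_c_smooth CH1))) H1_0.
pose F x := F0 x - F0 (- A).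
have Fder x : is_derive x 1 F (H1 x).
  by apply: (is_derive_eq (is_derive1B (F0der x) (is_derive_cst _ _ _))); rewrite subr0.
have CF : smooth F.
  by constructor=> -[//|n]; apply: (smooth_uptoS Fder); case: (smooth_c_smooth CH1).
have gA : g (- A) = 0 by rewrite gM// normrN gtr0_norm.
have Fg x : `|x| <= 2 * A -> `|F x - g x| <= d * (3 * A).
  move=> xA.
  have dFg y : is_derive (y : R) 1 (fun y => F y - g y) (H1 y - dg y) by exact: is_derive1B.
  have [c [c1 c2]] := is_derive1_mvt dFg x (- A).
  rewrite gA /F subrr !subr0 => ->.
  have xA' := xA; rewrite ler_norml in xA'; case/andP: xA' => x1 x2.
  have cA : - (2 * A) <= c <= 2 * A.
    rewrite (le_trans _ c1)/=; last by rewrite le_min; apply/andP; split; lra.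
    by rewrite (le_trans c2)// ge_max; apply/andP; split; lra.
  rewrite normrM ler_pM//.
    by rewrite H1E; [exact: HH|rewrite ler_norml].
  by rewrite opprK ler_norml; apply/andP; split; lra.
have gcut : g = (fun x => g x * cut chi A x).
  apply/funext => x; have [xA|Ax] := leP `|x| A; first by rewrite (cut1 chi1)// mulr1.
  by rewrite gM ?mul0r// (lt_trans MA).
have dgE x : dg x = dg x * cut chi A x + g x * derive1 (cut chi A) x.
  have := is_derive1M (gdg x) (smooth_is_derive (smooth_c_smooth cutA) x).
  by rewrite -gcut => /derive1_eq <-; rewrite (derive1_eq (gdg x)).
have cut01 x : 0 <= cut chi A x <= 1 by exact: chi01.
have dcut x : `|derive1 (cut chi A) x| <= B / A.
  rewrite (derive1_comp_affine _ _ _ chi_smooth) normrM.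
  by rewrite [X in _ * X]gtr0_norm ?invr_gt0// ler_wpM2r ?invr_ge0 ?(ltW A0).
exists (fun x => F x * cut chi A x); split.
- exact: smooth_cMl.
- move=> x; rewrite {1}gcut distrC -mulrBl.
  have [Ax|xA] := leP (2 * A) `|x|; first by rewrite cut_support// mulr0 normr0 ltW.
  have /andP[c0 c1] := cut01 x.
  rewrite normrM (ger0_norm c0).
  have h1 : `|F x - g x| * cut chi A x <= `|F x - g x| by rewrite ler_piMr.
  have := Fg x (ltW xA).
  have dA0 : 0 <= d * (3 * A) by apply: mulr_ge0; [exact: ltW|apply: mulr_ge0 => //; exact: ltW].
  have : 0 <= d * (3 * A) * (B / A) by exact: mulr_ge0.
  by rewrite -dE; lra.
- move=> x.
  rewrite (derive1_eq (is_derive1M (Fder x) (smooth_is_derive (smooth_c_smooth cutA) x))).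
  rewrite {1}dgE distrC.
  have -> : H1 x * cut chi A x + F x * derive1 (cut chi A) x -
      (dg x * cut chi A x + g x * derive1 (cut chi A) x) =
      (H1 x - dg x) * cut chi A x + (F x - g x) * derive1 (cut chi A) x by ring.
  have [Ax|xA] := ltP (2 * A) `|x|.
    rewrite (cut_support A0 (ltW Ax)).
    rewrite (@derive1_outside_support _ _ (2 * A))// => [|y yA]; last by rewrite cut_support//
      ltW.
    by rewrite !mulr0 addr0 normr0 ltW.
  have /andP[c0 c1] := cut01 x.
  have h1 : `|(H1 x - dg x) * cut chi A x| <= d.
    rewrite normrM (ger0_norm c0) (le_trans (y := `|H1 x - dg x|))// ?ler_piMr//.
    by rewrite H1E//; apply: HH; rewrite -ler_norml.
  have h2 : `|(F x - g x) * derive1 (cut chi A) x| <= d * (3 * A) * (B / A).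
    by rewrite normrM ler_pM// Fg.
  have : 0 <= d * (3 * A) by apply: mulr_ge0; [exact: ltW|apply: mulr_ge0 => //; exact: ltW].
  have := ler_normD ((H1 x - dg x) * cut chi A x) ((F x - g x) * derive1 (cut chi A) x).
  by rewrite -dE; lra.
Qed.

End smooth_density.

(** * Secant extensions *)

Section secant.
Variable R : realType.
Implicit Types (f g phi psi : R -> R) (x p q a alpha : R) (z : R[i]).

(** The real affine map agreeing with [f] at [p] and [q], evaluated at a complex point. *)
Definition secant p q f z : R[i] :=
  ((f p - f q) / (p - q))%:C * z + (f p - (f p - f q) / (p - q) * p)%:C.

(* The two points at which [extension a alpha f z] evaluates [f]. *)
Definition foot1 a z : R := complex.Re z + a * complex.Im z.
Definition foot2 a alpha z : R := complex.Re z - (alpha - a) * complex.Im z.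

Lemma extension_secant a alpha f z : 0 < alpha -> upper_half_plane z ->
  extension a alpha f z = secant (foot1 a z) (foot2 a alpha z) f z.
Proof.
case: z => x y al0; rewrite /upper_half_plane/= => y0.
rewrite /extension /secant /foot1 /foot2 /= gt_eqF//.
set u := f (x + _); set v := f (x - _).
have aln : alpha != 0 by rewrite gt_eqF.
have yn : y != 0 by rewrite gt_eqF.
have d0 : x + a * y - (x - (alpha - a) * y) != 0.
  have -> : x + a * y - (x - (alpha - a) * y) = alpha * y by ring.
  by rewrite mulf_neq0.
have -> : 'i / alpha%:C = 0 +i* alpha^-1 :> R[i].
  by rewrite -fmorphV -complexiE; apply/eqP; rewrite eq_complex/= !mul0r !mul1r subrr add0r !eqxx.
by apply/eqP; rewrite eq_complex/=; apply/andP; split; apply/eqP; field; rewrite ?aln ?d0.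
Qed.

(** This equivariance lets the pair [a], [alpha] found at [z0] serve at every point of the
    half-plane. *)
Lemma foot_affine a z (s t : R) : foot1 a (s%:C * z + t%:C) = s * foot1 a z + t.
Proof. by case: z => x y; rewrite /foot1/=; ring. Qed.

Lemma foot2_affine a alpha z (s t : R) :
  foot2 a alpha (s%:C * z + t%:C) = s * foot2 a alpha z + t.
Proof. by case: z => x y; rewrite /foot2/=; ring. Qed.

Lemma foot_neq a alpha z : 0 < alpha -> upper_half_plane z ->
  foot2 a alpha z < foot1 a z.
Proof.
case: z => x y al0; rewrite /upper_half_plane/= => y0.
rewrite /foot1 /foot2 /= -subr_gt0.
have -> : x + a * y - (x - (alpha - a) * y) = alpha * y by ring.
by rewrite mulr_gt0.
Qed.

Lemma secant_comp p q f g z : p != q -> g p != g q ->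
  secant (g p) (g q) f (secant p q g z) = secant p q (f \o g) z.
Proof.
rewrite -subr_eq0 -[g p == _]subr_eq0 => pq gpq; rewrite /secant /=.
have -> : (f (g p) - f (g q)) / (p - q) =
    (f (g p) - f (g q)) / (g p - g q) * ((g p - g q) / (p - q)).
  by field; rewrite gpq pq.
set m := _ / (g p - g q); set n := (g p - g q) / (p - q).
rewrite mulrDr mulrA -!rmorphM -addrA -rmorphD /=.
by congr (_ + _%:C); ring.
Qed.

(** The interpolant is affine, so it carries the feet of [z] to the feet of its image. With
    [secant_comp], this makes the secant extension multiplicative. *)
Lemma foot1_secant a alpha g z : 0 < alpha -> upper_half_plane z ->
  foot1 a (secant (foot1 a z) (foot2 a alpha z) g z) = g (foot1 a z).
Proof. by move=> al0 Hz; rewrite /secant foot_affine; ring. Qed.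

Lemma foot2_secant a alpha g z : 0 < alpha -> upper_half_plane z ->
  foot2 a alpha (secant (foot1 a z) (foot2 a alpha z) g z) = g (foot2 a alpha z).
Proof.
move=> al0 Hz; rewrite /secant foot2_affine.
have := foot_neq a al0 Hz; rewrite -subr_gt0 => /lt0r_neq0 d0.
by field.
Qed.

Lemma secantD p q f g z : secant p q (fun x => f x + g x) z = secant p q f z + secant p q g z.
Proof.
rewrite /secant.
have -> : (f p + g p - (f q + g q)) / (p - q) = (f p - f q) / (p - q) + (g p - g q) / (p - q).
  by rewrite -mulrDl; congr (_ / _); ring.
set m := (f p - _) / _; set n := (g p - _) / _.
have -> : f p + g p - (m + n) * p = (f p - m * p) + (g p - n * p) by ring.
by rewrite !rmorphD/= mulrDl addrACA.
Qed.

Lemma secant_id p q z : p != q -> secant p q id z = z.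
Proof.
by rewrite -subr_eq0 => pq; rewrite /secant divff// mul1r mul1r subrr addr0.
Qed.

Lemma secant_bound p q z : exists2 C : R, 0 <= C & forall f e,
  `|f p| <= e -> `|f q| <= e -> modc (secant p q f z) <= C * e.
Proof.
exists (2 / `|p - q| * (modc z + `|p|) + 1) => [|f e fp fq].
  by rewrite addr_ge0// mulr_ge0 ?divr_ge0 ?addr_ge0 ?modc_ge0.
have m_le : `|(f p - f q) / (p - q)| <= 2 / `|p - q| * e.
  rewrite normrM normfV mulrAC ler_wpM2r ?invr_ge0//.
  by rewrite (le_trans (ler_normB _ _))// mulr_natl mulr2n lerD.
rewrite /secant (le_trans (modcD _ _))// modcM !modc_real.
have h1 := ler_wpM2r (modc_ge0 z) m_le.
have h2 := ler_wpM2r (normr_ge0 p) m_le.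
have := ler_normB (f p) ((f p - f q) / (p - q) * p).
rewrite normrM; lra.
Qed.

End secant.

(** * Continuously differentiable functions and their smooth approximation *)

Section C1_functions.
Variable R : realType.
Implicit Types (f g phi psi : R -> R) (x : R).

Lemma C1_is_derive f : C1 f -> forall x : R, is_derive x 1 f (derive1 f x).
Proof. by move=> [+ _] x => /(_ x); exact: derivable_is_derive1. Qed.

Lemma C1_of_is_derive f (df : R -> R) : (forall x : R, is_derive x 1 f (df x)) ->
  continuous df -> C1 f.
Proof.
move=> fdf cdf; split; first by move=> x; have [] := fdf x.
by rewrite (_ : derive1 f = df)//; apply/funext => x; exact: derive1_eq.
Qed.

Lemma smooth_C1 f : smooth f -> C1 f.
Proof.
move=> Hf; apply: (C1_of_is_derive (smooth_is_derive Hf)).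
exact: is_derive1_continuous (smooth_is_derive (smooth_derive1 Hf)).
Qed.

Lemma continuous_add f g : continuous f -> continuous g -> continuous (fun x => f x + g x).
Proof. by move=> cf cg x; exact: cvgD (cf x) (cg x). Qed.

Lemma continuous_mul f g : continuous f -> continuous g -> continuous (fun x => f x * g x).
Proof. by move=> cf cg x; exact: cvgM (cf x) (cg x). Qed.

Lemma continuous_inv f : (forall x, f x != 0) -> continuous f ->
  continuous (fun x => (f x)^-1).
Proof. by move=> f0 cf x; exact: cvgV (f0 x) (cf x). Qed.

Lemma C1D f g : C1 f -> C1 g -> C1 (fun x => f x + g x).
Proof.
move=> Hf Hg; apply: (@C1_of_is_derive _ (fun x => derive1 f x + derive1 g x)).
  by move=> x; apply: is_derive1D; exact: C1_is_derive.
exact: continuous_add (proj2 Hf) (proj2 Hg).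
Qed.

Lemma C1M f g : C1 f -> C1 g -> C1 (fun x => f x * g x).
Proof.
move=> Hf Hg; apply: (@C1_of_is_derive _ (fun x => derive1 f x * g x + f x * derive1 g x)).
  by move=> x; apply: is_derive1M; exact: C1_is_derive.
have cf := is_derive1_continuous (C1_is_derive Hf).
have cg := is_derive1_continuous (C1_is_derive Hg).
exact: continuous_add (continuous_mul (proj2 Hf) cg) (continuous_mul cf (proj2 Hg)).
Qed.

Lemma cvgy0P f : f x @[x --> +oo] --> (0 : R) <->
  forall e, 0 < e -> exists A : R, forall x, A < x -> `|f x| <= e.
Proof.
split=> [/cvgrPdist_le H e e0|H].
  have [A [_ HA]] := H _ e0; exists A => x Ax.
  by have := HA x Ax; rewrite sub0r normrN.
apply/cvgrPdist_le => e e0; have [A HA] := H _ e0.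
by exists A; split; [exact: num_real|move=> x Ax; rewrite sub0r normrN; exact: HA].
Qed.

Lemma cvgNy0P f : f x @[x --> -oo] --> (0 : R) <->
  forall e, 0 < e -> exists A : R, forall x, x < A -> `|f x| <= e.
Proof.
split=> [/cvgrPdist_le H e e0|H].
  have [A [_ HA]] := H _ e0; exists A => x Ax.
  by have := HA x Ax; rewrite sub0r normrN.
apply/cvgrPdist_le => e e0; have [A HA] := H _ e0.
by exists A; split; [exact: num_real|move=> x Ax; rewrite sub0r normrN; exact: HA].
Qed.

Lemma C1_0P f : C1_0 f <-> C1 f /\ forall e, 0 < e ->
  exists A : R, forall x, A <= `|x| -> `|f x| <= e /\ `|derive1 f x| <= e.
Proof.
split=> [[Cf /cvgy0P f1 /cvgNy0P f2 /cvgy0P f3 /cvgNy0P f4]|[Cf H]].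
  split=> // e e0.
  have [A1 H1] := f1 _ e0; have [A2 H2] := f2 _ e0.
  have [A3 H3] := f3 _ e0; have [A4 H4] := f4 _ e0.
  exists (`|A1| + `|A2| + `|A3| + `|A4| + 1) => x.
  have := ler_norm A1; have := ler_norm (- A2); rewrite normrN.
  have := ler_norm A3; have := ler_norm (- A4); rewrite normrN.
  have := normr_ge0 A1; have := normr_ge0 A2; have := normr_ge0 A3; have := normr_ge0 A4.
  have [x0|x0] := leP 0 x; [rewrite (ger0_norm x0)|rewrite (ltr0_norm x0)] => *.
    by split; [apply: H1|apply: H3]; lra.
  by split; [apply: H2|apply: H4]; lra.
split => //; [apply/cvgy0P|apply/cvgNy0P|apply/cvgy0P|apply/cvgNy0P] => e e0;
  have [A HA] := H _ e0.
- by exists A => x Ax; apply: (HA x _).1; rewrite (le_trans (ltW Ax))// ler_norm.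
- exists (- A) => x Ax; apply: (HA x _).1; have := ler_norm (- x); rewrite normrN; lra.
- by exists A => x Ax; apply: (HA x _).2; rewrite (le_trans (ltW Ax))// ler_norm.
- exists (- A) => x Ax; apply: (HA x _).2; have := ler_norm (- x); rewrite normrN; lra.
Qed.

Lemma smooth_c_C1_0 phi : smooth_c phi -> C1_0 phi.
Proof.
move=> Hphi; apply/C1_0P; split; first by apply: smooth_C1; case: Hphi.
case: Hphi => _ [M M0 HM] e e0; exists (M + 1) => x xM.
have Mx : M < `|x| by lra.
by rewrite HM// (derive1_outside_support HM)// normr0 ltW.
Qed.

(** The difference is written in the shape used by [linear_functional_on], with scalar [-1]. *)
Lemma C1_0B phi psi : C1_0 phi -> C1_0 psi -> C1_0 (fun x => -1 * psi x + phi x).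
Proof.
move=> /C1_0P[Cphi Hphi] /C1_0P[Cpsi Hpsi]; apply/C1_0P; split.
  by apply: C1D => //; apply: C1M => //; exact: smooth_C1 (smooth_cst _).
move=> e e0; have e2 : 0 < e / 2 by rewrite divr_gt0.
have [A HA] := Hphi _ e2; have [B HB] := Hpsi _ e2.
exists (`|A| + `|B|) => x xAB.
have [|h1 h2] := HA x; first by have := ler_norm A; have := normr_ge0 B; lra.
have [|h3 h4] := HB x; first by have := ler_norm B; have := normr_ge0 A; lra.
have dE : derive1 (fun x => -1 * psi x + phi x) x = - derive1 psi x + derive1 phi x.
  apply: derive1_eq; apply: (is_derive_eq (is_derive1D (is_derive1M (is_derive_cst _ _ _)
    (C1_is_derive Cpsi x)) (C1_is_derive Cphi x))).
  by rewrite mul0r add0r mulN1r.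
rewrite dE mulN1r; split.
  by rewrite (le_trans (ler_normD _ _))// normrN; lra.
by rewrite (le_trans (ler_normD _ _))// normrN; lra.
Qed.

Lemma C1_0_bounded phi : C1_0 phi -> exists2 B : R, 0 <= B & forall x, `|phi x| <= B.
Proof.
move=> /C1_0P[Cphi /(_ _ ltr01)[A HA]].
have [K K0 HK] := continuous_bounded_on A (is_derive1_continuous (C1_is_derive Cphi)).
exists (K + 1) => [|x]; first by rewrite addr_ge0.
have [xA|/ltW Ax] := leP `|x| A; first by rewrite (le_trans (HK x xA))// lerDl.
by have [h _] := HA x Ax; rewrite (le_trans h)// lerDr.
Qed.

Variable chi : R -> R.
Hypothesis chi_smooth : smooth chi.
Hypothesis chi01 : forall x, 0 <= chi x <= 1.
Hypothesis chi1 : forall x, `|x| <= 1 -> chi x = 1.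
Hypothesis chi0 : forall x, 2 <= `|x| -> chi x = 0.

(** No decay of [phi] is assumed: besides [C1_0], this serves perturbations of linear growth in
    [near_identity_base]. *)
Lemma C1_cut_approx phi (A e : R) : C1 phi -> 0 < A -> 0 < e ->
  exists psi, [/\ smooth_c psi, forall x, `|phi x * cut chi A x - psi x| <= e &
    forall x, `|derive1 phi x * cut chi A x + phi x * derive1 (cut chi A) x
      - derive1 psi x| <= e].
Proof.
move=> Cphi A0 e0.
have Hcut := cut_smooth_c chi_smooth chi0 A0.
have dcut := smooth_is_derive (smooth_c_smooth Hcut).
have Cg := C1M Cphi (smooth_C1 (smooth_c_smooth Hcut)).
have dg x := is_derive1M (C1_is_derive Cphi x) (dcut x).
have cdg : continuous (fun x => derive1 phi x * cut chi A x + phi x * derive1 (cut chi A) x).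
  have [_ cdg] := Cg; rewrite (_ : (fun x => _) = derive1 (fun x => phi x * cut chi A x))//.
  by apply/funext => x; rewrite (derive1_eq (dg x)).
apply: (smooth_c_approx_C1 chi_smooth chi01 chi1 chi0 (M := 2 * A) dg cdg) => // x xA.
by rewrite (cut_support chi0)// ?mulr0// ltW.
Qed.

Lemma C1_0_approx phi (e : R) : C1_0 phi -> 0 < e ->
  exists psi, [/\ smooth_c psi, forall x, `|phi x - psi x| <= e &
    forall x, `|derive1 phi x - derive1 psi x| <= e].
Proof.
move=> Hphi e0; have [B B0 HB] := C1_0_bounded Hphi.
have [B1 B10 HB1] := smooth_c_bounded (smooth_c_derive1 (chi_smooth_c chi_smooth chi0)).
have [Cphi /(_ (e / 3))[|A0 HA0]] := (C1_0P phi).1 Hphi; first by rewrite divr_gt0.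
have e3 : 0 < e / 3 by rewrite divr_gt0.
have BB0 : 0 <= B * B1 / (e / 3) by rewrite divr_ge0 ?(ltW e3)// mulr_ge0.
(* Beyond [A0] the function and its derivative are at most [e / 3]; the second term makes [phi]
   times the derivative of the cutoff at most [e / 3] as well. *)
pose A : R := `|A0| + B * B1 / (e / 3) + 1.
have A_gt0 : 0 < A by rewrite ltr_wpDl// addr_ge0.
have AA0 : A0 <= A by have := ler_norm A0; rewrite /A; lra.
have BA : B * B1 / A <= e / 3.
  rewrite ler_pdivrMr// [e / 3 * A]mulrC -ler_pdivrMr// /A.
  by have := normr_ge0 A0; lra.
have [psi [Hpsi h1 h2]] := C1_cut_approx Cphi A_gt0 e3.
have small f x : (forall x, A0 <= `|x| -> `|f x| <= e / 3) ->
    `|f x - f x * cut chi A x| <= e / 3.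
  move=> fA0; have [xA|Ax] := leP `|x| A.
    by rewrite (cut1 chi1)// mulr1 subrr normr0 ltW.
  have /andP[c0 c1] := chi01 (A^-1 * x + 0); rewrite -/(cut chi A x) in c0 c1.
  rewrite -[X in X - _]mulr1 -mulrBr normrM.
  rewrite (le_trans (y := `|f x|)) ?fA0//; last by rewrite (le_trans AA0)// ltW.
  by rewrite ler_piMr// ger0_norm//; lra.
exists psi; split => // x.
  have := small phi x (fun x Ax => (HA0 x Ax).1); have := h1 x.
  have := ler_normD (phi x - phi x * cut chi A x) (phi x * cut chi A x - psi x).
  by rewrite addrA subrK; lra.
have h3 := small (derive1 phi) x (fun x Ax => (HA0 x Ax).2).
have h4 : `|phi x * derive1 (cut chi A) x| <= e / 3.
  apply: le_trans BA; rewrite normrM -mulrA ler_pM//.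
  rewrite (derive1_comp_affine _ _ _ chi_smooth) normrM [X in _ * X]gtr0_norm ?invr_gt0//.
  by rewrite ler_wpM2r ?invr_ge0 ?(ltW A_gt0).
have := h2 x; set u := _ + _; rewrite {}/u => h5.
have -> : derive1 phi x - derive1 psi x =
   (derive1 phi x - derive1 phi x * cut chi A x) + - (phi x * derive1 (cut chi A) x) +
   (derive1 phi x * cut chi A x + phi x * derive1 (cut chi A) x - derive1 psi x) by ring.
rewrite (le_trans (ler_normD _ _))//.
have := ler_normD (derive1 phi x - derive1 phi x * cut chi A x) (- (phi x * derive1 (cut chi A)
  x)).
by rewrite normrN; lra.
Qed.

End C1_functions.

(** * Bounded functionals on [C1_0] *)

Section C1_0_functional.
Variables (R : realType) (z0 : R[i]) (L : (R -> R) -> R[i]) (p q : R).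
Hypothesis L_linear : linear_functional_on (@C1_0 R) L.
Hypothesis L_bounded : bounded_functional_on_C1_0 L.
Hypothesis L_secant : forall phi, smooth_c phi -> L phi = secant p q phi z0.

Lemma C1_0_functional_secant phi : C1_0 phi -> L phi = secant p q phi z0.
Proof.
move=> Hphi; have [chi [chi_smooth chi01 chi1 chi0]] := exists_cutoff R.
have [C C0 HC] := secant_bound p q z0.
have [M HM] := L_bounded.
apply: modc_small_eq => e e0.
have Q0 : 0 < 2 * `|M| + C + 1 by rewrite ltr_wpDl// addr_ge0// mulr_ge0.
(* An approximation within [d] for values and derivatives costs [2 |M| d] in [L], as [norm1oo] is a
   sum of two suprema, and [C d] in the secant. *)
pose d := e / (2 * `|M| + C + 1).
have d0 : 0 < d by rewrite divr_gt0.
have dE : d * (2 * `|M| + C + 1) = e by rewrite divfK// gt_eqF.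
have [psi [Hpsi h1 h2]] := C1_0_approx chi_smooth chi01 chi1 chi0 Hphi d0.
have Cpsi := smooth_c_C1_0 Hpsi.
have CD := C1_0B Hphi Cpsi.
pose D x := -1 * psi x + phi x.
have LE : L D = L phi - L psi.
  by rewrite (L_linear (-1) Cpsi Hphi) rmorphN mulN1r addrC.
have DE x : D x = phi x - psi x by rewrite /D mulN1r addrC.
have D_le x : `|D x| <= d by rewrite DE.
have dD_le x : `|derive1 D x| <= d.
  have -> : derive1 D x = derive1 phi x - derive1 psi x.
    have -> : D = (fun x => phi x - psi x) by apply/funext.
    apply: derive1_eq; apply: is_derive1B.
      by apply: C1_is_derive; case/C1_0P: Hphi.
    by apply: C1_is_derive; case/C1_0P: Cpsi.
  exact: h2.
have LD_le : modc (L D) <= 2 * `|M| * d.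
  have := HM _ CD; rewrite modcE lecR => /le_trans; apply.
  have n0 : 0 <= norm1oo D by rewrite addr_ge0 ?supnorm_ge0.
  have n2 : norm1oo D <= 2 * d.
    by rewrite mulr_natl mulr2n lerD ?supnorm_le.
  apply: (le_trans (ler_wpM2r n0 (ler_norm M))).
  by have := ler_wpM2l (normr_ge0 M) n2; lra.
have sE : secant p q phi z0 = secant p q D z0 + L psi.
  rewrite (L_secant Hpsi) -secantD; congr secant.
  by apply/funext => x; rewrite DE subrK.
have -> : L phi - secant p q phi z0 = L D + - secant p q D z0.
  by rewrite sE LE; ring.
rewrite (le_trans (modcD _ _))// modcN.
by have := HC D d (D_le p) (D_le q); rewrite -dE; lra.
Qed.

End C1_0_functional.

(** * The extension formula when the expansion has no remainder *)

Section linear_case.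
Variables (R : realType) (E : (R -> R) -> R[i] -> R[i]).
Hypothesis E_half_plane : forall f z, BLip f -> upper_half_plane z ->
  upper_half_plane (E f z).
Hypothesis E_affine : forall a b : R, 0 < a -> forall z, upper_half_plane z ->
  E (fun x : R => a * x + b) z = a%:C * z + b%:C.
Hypothesis E_comp : forall f g, BLip f -> BLip g ->
  forall z, upper_half_plane z -> E (f \o g) z = E f (E g z).
Hypothesis E_cont : forall (f_ : nat -> R -> R) (f : R -> R),
  (forall n, BLip (f_ n)) -> BLip f -> {family compact, f_ @ \oo --> f} ->
  forall z, upper_half_plane z ->
    (E (f_ n) z : R[i]^o) @[n --> \oo] --> (E f z : R[i]^o).
Variables (z0 : R[i]) (e0 : R) (L : (R -> R) -> R[i]) (a alpha : R).
Hypothesis z0_half_plane : upper_half_plane z0.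
Hypothesis e0_itv : 0 < e0 < 1.
Hypothesis alpha_gt0 : 0 < alpha.
Hypothesis E_expand : forall phi, Binf e0 phi ->
  E (fun x : R => x + phi x) z0 = z0 + L phi.
Hypothesis L_secant : forall phi, smooth_c phi ->
  L phi = secant (foot1 a z0) (foot2 a alpha z0) phi z0.
Implicit Types (f g phi psi : R -> R) (x : R).

Let p := foot1 a z0.
Let q := foot2 a alpha z0.

(** Although [phi] may be unbounded, [|phi x| <= |phi 0| + d |x|]. As [x] times the derivative of
    the cutoff is bounded at all scales, truncation keeps the derivative small and (P4) passes from
    the truncations to [phi]. *)
Lemma near_identity_base : exists2 d : R, 0 < d < 1 & forall phi, C1 phi -> derive_le d phi ->
  E (fun x => x + phi x) z0 = secant p q (fun x => x + phi x) z0.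
Proof.
have [chi [chi_smooth chi01 chi1 chi0]] := exists_cutoff R.
have [B1 B10 HB1] := smooth_c_bounded (smooth_c_derive1 (chi_smooth_c chi_smooth chi0)).
have [B2 B20 HB2] := smooth_c_bounded (smooth_cMl smooth_id (smooth_c_derive1 (chi_smooth_c
  chi_smooth chi0))).
have [e0_gt0 e01] := andP e0_itv.
have B40 : 0 < 4 + B2 by rewrite ltr_pwDl.
(* The truncated and smoothed [psi] has derivative at most [d (3 + B2)]: [d] from [phi'], [d + d B2]
   from the cutoff, [d] from smoothing. This must be less than [e0]. *)
pose d := e0 / (4 + B2).
have d0 : 0 < d by rewrite divr_gt0.
have dE : d * (4 + B2) = e0 by rewrite divfK// gt_eqF.
have dB : 0 <= d * B2 by apply: mulr_ge0 => //; exact: ltW.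
exists d; first by rewrite mulrDr in dE; apply/andP; split => //; lra.
move=> phi Cphi phid.
have d1 : d < 1 by rewrite mulrDr in dE; lra.
have Bphi : BLip (fun x => x + phi x) := BLip_id_add (proj1 Cphi) phid d1.
have [C C0 HC] := secant_bound p q z0.
have pq : p != q by rewrite gt_eqF//; exact: foot_neq.
apply: modc_small_eq => e e_gt0.
have C10 : 0 < C + 1 by rewrite ltr_wpDl.
pose e1 := e / (C + 1).
have e10 : 0 < e1 by rewrite divr_gt0.
have e1E : e1 * (C + 1) = e by rewrite divfK// gt_eqF.
have [N HN] := local_uniform_continuity E_cont Bphi z0_half_plane e10.
pose eta := Num.min (Num.min N.+1%:R^-1 d) e1.
have eta0 : 0 < eta by rewrite !lt_min e10 d0 invr_gt0 ltr0n.
have etaN : eta <= N.+1%:R^-1 by rewrite !ge_min lexx.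
have etad : eta <= d by rewrite !ge_min lexx ?orbT.
have etae : eta <= e1 by rewrite !ge_min lexx ?orbT.
have N0 : 0 <= N%:R :> R by [].
have p0 := normr_ge0 p; have q0 := normr_ge0 q.
have BB0 : 0 <= `|phi 0| * B1 / d by rewrite divr_ge0 ?(ltW d0)// mulr_ge0.
pose A : R := N%:R + `|p| + `|q| + `|phi 0| * B1 / d + 1.
have A0 : 0 < A by rewrite /A; lra.
have BA : `|phi 0| * B1 / A <= d.
  by rewrite ler_pdivrMr// [d * A]mulrC -ler_pdivrMr// /A; lra.
have [psi [Hpsi h1 h2]] := C1_cut_approx chi_smooth chi01 chi1 chi0 Cphi A0 eta0.
have dcut x : derive1 (cut chi A) x = derive1 chi (A^-1 * x + 0) * A^-1.
  exact: derive1_comp_affine.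
have psiK : derive_le (d * (3 + B2)) psi.
  move=> x.
  have k1 : `|derive1 phi x * cut chi A x| <= d.
    have /andP[c0 c1] := chi01 (A^-1 * x + 0).
    by rewrite normrM (le_trans _ (phid x))// ler_piMr// ger0_norm.
  have k2 : `|phi x| <= `|phi 0| + d * `|x|.
    have := is_derive1_lipschitz (C1_is_derive Cphi) phid x 0; rewrite subr0.
    have := ler_normD (phi x - phi 0) (phi 0); rewrite subrK; lra.
  have k3 : `|derive1 (cut chi A) x| <= B1 / A.
    rewrite dcut normrM [X in _ * X]gtr0_norm ?invr_gt0//.
    by rewrite ler_wpM2r ?invr_ge0 ?(ltW A0).
  have k4 : `|x| * `|derive1 (cut chi A) x| <= B2.
    rewrite -normrM dcut.
    have -> : x * (derive1 chi (A^-1 * x + 0) / A) = (A^-1 * x + 0) * derive1 chi (A^-1 * x + 0).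
      by rewrite addr0; ring.
    exact: HB2.
  have k5 : `|phi x * derive1 (cut chi A) x| <= d + d * B2.
    rewrite normrM.
    apply: (le_trans (ler_wpM2r (normr_ge0 (derive1 (cut chi A) x)) k2)).
    rewrite mulrDl -mulrA lerD//; last by rewrite ler_wpM2l// ltW.
    by rewrite (le_trans _ BA)// -mulrA ler_wpM2l.
  have k6 := h2 x.
  have k7 := ler_normD (derive1 phi x * cut chi A x) (phi x * derive1 (cut chi A) x).
  have k8 := ler_normB (derive1 phi x * cut chi A x + phi x * derive1 (cut chi A) x)
    (derive1 phi x * cut chi A x + phi x * derive1 (cut chi A) x - derive1 psi x).
  rewrite opprB addrCA subrr addr0 in k8.
  lra.
have psi_e0 : d * (3 + B2) < e0 by rewrite -dE; lra.
have cutE x : `|x| <= A -> `|psi x - phi x| <= eta.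
  by move=> xA; have := h1 x; rewrite (cut1 chi1)// mulr1 distrC.
have Bpsi : BLip (fun x => x + psi x).
  exact: BLip_id_add (proj1 (smooth_C1 (smooth_c_smooth Hpsi))) psiK (lt_trans psi_e0 e01).
have c1 : modc (E (fun x => x + psi x) z0 - E (fun x => x + phi x) z0) <= e1.
  apply: HN Bpsi _ => x xN.
  have -> : x + psi x - (x + phi x) = psi x - phi x by ring.
  by rewrite (le_trans (cutE x _) etaN)// (le_trans xN)// /A; lra.
have E1 : E (fun x => x + psi x) z0 = secant p q (fun x => x + psi x) z0.
  rewrite E_expand; last exact: (Binf_derive_le Hpsi psiK).
  by rewrite (L_secant Hpsi) (secantD p q id psi) (secant_id _ pq).
have c2 : modc (secant p q (fun x => psi x - phi x) z0) <= C * e1.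
  apply: HC; first by rewrite (le_trans (cutE p _) etae)// /A; lra.
  by rewrite (le_trans (cutE q _) etae)// /A; lra.
have E2 : secant p q (fun x => x + psi x) z0 =
    secant p q (fun x => x + phi x) z0 + secant p q (fun x => psi x - phi x) z0.
  by rewrite -secantD; congr secant; apply/funext => x; ring.
rewrite E1 E2 in c1.
set s := secant p q (fun x => x + phi x) z0 in c1 *.
set t := secant p q (fun x => psi x - phi x) z0 in c1 c2.
rewrite modcB.
have -> : s - E (fun x => x + phi x) z0 = (s + t - E (fun x => x + phi x) z0) + - t by ring.
rewrite (le_trans (modcD _ _))// modcN.
by rewrite -e1E; lra.
Qed.

Definition is_secant_ext f := forall z, upper_half_plane z ->
  E f z = secant (foot1 a z) (foot2 a alpha z) f z.

(** Conjugating by the affine map that takes [z0] to [w] replaces [phi] by [phi1], whose derivative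
    satisfies the same bound; hence one [d] works at all points. *)
Lemma near_identity : exists2 d : R, 0 < d < 1 & forall phi, C1 phi -> derive_le d phi ->
  is_secant_ext (fun x => x + phi x).
Proof.
have [d d01 Hd] := near_identity_base; exists d => // phi Cphi phid w Hw.
have [d0 d1] := andP d01.
have [s [t [s0 wE _ _]]] := half_plane_affine z0_half_plane Hw.
have sn : s != 0 by rewrite gt_eqF.
have Bphi : BLip (fun x => x + phi x) := BLip_id_add (proj1 Cphi) phid d1.
pose phi1 x := s^-1 * phi (s * x + t).
have dphi1 (x : R) : is_derive x 1 phi1 (derive1 phi (s * x + t)).
  have dc := @is_derive1_cmp _ phi (fun x => s * x + t) x _ _ (C1_is_derive Cphi _)
    (is_derive1_affine s t x).
  apply: (is_derive_eq (is_derive1M (is_derive_cst _ _ _) dc)).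
  by rewrite mul0r add0r mulrCA mulVf// mulr1.
have phi1d : derive_le d phi1 by move=> x; rewrite (derive1_eq (dphi1 x)).
have Cphi1 : C1 phi1.
  apply: (C1_of_is_derive dphi1) => x.
  apply: (@continuous_comp _ _ _ (fun x => s * x + t)); last exact: (proj2 Cphi).
  by have := is_derive1_continuous (is_derive1_affine s t); apply.
have Bphi1 : BLip (fun x => x + phi1 x) := BLip_id_add (proj1 Cphi1) phi1d d1.
have pq : p - q != 0 by rewrite subr_eq0 gt_eqF//; exact: foot_neq.
rewrite wE (E_at E_affine E_comp z0_half_plane s0 Bphi); last by rewrite -wE.
rewrite (_ : (fun x => s * x + t + phi (s * x + t)) = (fun x => s * (x + phi1 x) + t)); last
  first.
  by apply/funext => x; rewrite /phi1; field.
rewrite (E_affine_comp E_half_plane E_affine E_comp z0_half_plane t s0 Bphi1) (Hd _ Cphi1 phi1d).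
rewrite foot_affine foot2_affine -/p -/q /secant /phi1.
set u := phi (s * p + t); set v := phi (s * q + t).
have -> : (s * p + t + u - (s * q + t + v)) / (s * p + t - (s * q + t)) =
   (p + s^-1 * u - (q + s^-1 * v)) / (p - q).
  have spq : s * p + t - (s * q + t) != 0.
    have -> : s * p + t - (s * q + t) = s * (p - q) by ring.
    by rewrite mulf_neq0.
  by field; rewrite sn pq spq.
set m := _ / (p - q).
have -> : s * p + t + u - m * (s * p + t) = s * (p + s^-1 * u - m * p) + t - m * t by field.
set r := p + s^-1 * u - m * p.
have -> : (s * r + t - m * t)%:C = s%:C * r%:C + t%:C - m%:C * t%:C.
  by rewrite rmorphB rmorphD !rmorphM.
by move: (s%:C) (r%:C) (t%:C) (m%:C) => cs cr ct cm; ring.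
Qed.

Lemma is_secant_ext_comp f g : BLip f -> BLip g ->
  is_secant_ext f -> is_secant_ext g -> is_secant_ext (f \o g).
Proof.
move=> Bf Bg Hf Hg z Hz.
have lt := foot_neq a alpha_gt0 Hz.
rewrite E_comp// Hf; last exact: E_half_plane.
rewrite Hg// foot1_secant// foot2_secant// secant_comp//.
  by rewrite gt_eqF.
by rewrite gt_eqF//; case: Bg => + _ _; apply.
Qed.

Lemma BLplus_is_secant_ext f : BLplus f -> is_secant_ext f.
Proof.
move=> [Cf [b [B [b0 B0 fbB]]]].
have [d /andP[d0 d1] near_id] := near_identity.
(* The derivative of [F t] is a convex combination of 1 and [f'], so both values must lie in
   [[b1, B1]]. *)
pose b1 : R := Num.min 1 b; pose B1 : R := Num.max 1 B.
have b10 : 0 < b1 by rewrite lt_min ltr01.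
have b11 : b1 <= 1 by rewrite ge_min lexx.
have b1b : b1 <= b by rewrite ge_min lexx orbT.
have B11 : 1 <= B1 by rewrite le_max lexx.
have BB1 : B <= B1 by rewrite le_max lexx orbT.
pose F t x := (1 - t) * x + t * f x.
pose dF t x := (1 - t) + t * derive1 f x.
have FdF t (x : R) : is_derive x 1 (F t) (dF t x).
  apply: (is_derive_eq (is_derive1D (is_derive1M (is_derive_cst _ _ _) (is_derive_id _ _))
    (is_derive1M (is_derive_cst _ _ _) (C1_is_derive Cf x)))).
  by rewrite /dF !mul0r !add0r mulr1.
have dF_bound t x : 0 <= t <= 1 -> b1 <= dF t x <= B1.
  move=> /andP[t0 t1]; have /andP[f1 f2] := fbB x; rewrite /dF.
  have u0 : 0 <= 1 - t by lra.
  have h1 := ler_wpM2l t0 (le_trans b1b f1); have h2 := ler_wpM2l t0 (le_trans f2 BB1).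
  have h3 := ler_wpM2l u0 b11; have h4 := ler_wpM2l u0 B11.
  by apply/andP; split; lra.
have BF t : 0 <= t <= 1 -> BLip (F t).
  by move=> t01; apply: (BLip_of_derive b10 (FdF t)) => x; exact: dF_bound.
(* Each factor is [Id + phi] with [|phi'| <= (B1 + 1) / (b1 n)], which must not exceed [d]; the
   successor keeps [n] nonzero. *)
pose n := (Num.bound ((B1 + 1) / (b1 * d))).+1.
have n0 : 0 < n%:R :> R by rewrite ltr0n.
have n_large : (B1 + 1) / b1 * n%:R^-1 <= d.
  rewrite ler_pdivrMr// -ler_pdivrMl// mulrC -mulrA -invfM.
  have BD0 : 0 <= (B1 + 1) / (b1 * d) by rewrite divr_ge0 ?mulr_ge0 ?ltW//; lra.
  apply: (le_trans (ltW (archi_boundP BD0))).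
  by rewrite ler_nat.
suff H k : (k <= n)%N -> is_secant_ext (F (k%:R / n%:R)).
  have := H n (leqnn n); rewrite divff ?gt_eqF// /F.
  by under [X in is_secant_ext X -> _]eq_fun do rewrite subrr mul0r add0r mul1r.
elim: k => [_|k IH kn].
  rewrite mul0r (_ : F 0 = (fun x => x + 0)).
    apply: near_id; first exact: smooth_C1 (smooth_cst _).
    by move=> x; rewrite (derive1_eq (is_derive_cst _ _ _)) normr0 ltW.
  by apply/funext => x; rewrite /F subr0 mul1r mul0r.
have {}IH := IH (ltnW kn).
set t := k%:R / n%:R in IH.
have t01 : 0 <= t <= 1.
  by rewrite /t divr_ge0//= ler_pdivrMr// mul1r ler_nat ltnW.
have dFt_ge x : b1 <= dF t x by case/andP: (dF_bound t x t01).
have [h [Fh hF]] := derive_lower_bound_inverse b10 (FdF t) dFt_ge.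
have dFt_neq x : dF t x != 0 by rewrite gt_eqF// (lt_le_trans b10).
have dh (y : R) : is_derive y 1 h (dF t (h y))^-1.
  rewrite -{1}(hF y); apply: is_derive_inverse => //.
  - by near=> x; exact: Fh.
  - by near=> x; exact: (is_derive1_continuous (FdF t)).
(* Consecutive maps differ by [(f - Id) / n]; substituting the inverse [h] of [F t] gives
   [F (t + 1/n) o h = Id + phi]. *)
pose phi y := n%:R^-1 * (f (h y) - h y).
pose dphi y := n%:R^-1 * ((derive1 f (h y) - 1) * (dF t (h y))^-1).
have phi_der (y : R) : is_derive y 1 phi (dphi y).
  have dfh := is_derive1_cmp (C1_is_derive Cf (h y)) (dh y).
  apply: (is_derive_eq (is_derive1M (is_derive_cst _ _ _) (is_derive1B dfh (dh y)))).
  by rewrite mul0r add0r /dphi mulrBl mul1r.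
have ch : continuous h := is_derive1_continuous dh.
have cfh : continuous (fun y => derive1 f (h y)).
  by move=> y; apply: (@continuous_comp _ _ _ h); [exact: ch|exact: (proj2 Cf)].
have cc (c : R) : continuous (fun _ : R => c) by move=> y; exact: cvg_cst.
have Cphi : C1 phi.
  apply: (C1_of_is_derive phi_der); apply: continuous_mul => //.
  apply: continuous_mul; first exact: continuous_add.
  apply: continuous_inv => //.
  by apply: continuous_add => //; exact: continuous_mul.
have phid : derive_le d phi.
  move=> y; rewrite (derive1_eq (phi_der y)) /dphi.
  apply: le_trans n_large; rewrite mulrC normrM [X in _ * X]gtr0_norm ?invr_gt0//.
  rewrite ler_wpM2r ?invr_ge0 ?(ltW n0)// normrM normfV.
  have dF0 : 0 < dF t (h y) by rewrite (lt_le_trans b10).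
  rewrite (gtr0_norm dF0) ler_pM ?invr_ge0 ?(ltW dF0)//; last by rewrite lef_pV2.
  by have /andP[f1 f2] := fbB (h y); rewrite ler_norml; apply/andP; split; lra.
have -> : F (k.+1%:R / n%:R) = (fun y => y + phi y) \o F t.
  apply/funext => x; rewrite /= /phi Fh /F /t -natr1; field.
  by rewrite gt_eqF.
apply: is_secant_ext_comp => //.
- exact: BLip_id_add (proj1 Cphi) phid d1.
- exact: BF.
- exact: near_id.
Unshelve. all: by end_near.
Qed.

End linear_case.

Lemma linear_functional_onS (R : realType) (V W : set (R -> R)) (L : (R -> R) -> R[i]) :
  V `<=` W -> linear_functional_on W L -> linear_functional_on V L.
Proof. by move=> VW HL a phi psi /VW Wphi /VW Wpsi; exact: HL. Qed.

Lemma Cinf_c_C1_0 (R : realType) : @Cinf_c R `<=` @C1_0 R.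
Proof. by move=> phi /Cinf_cP; exact: smooth_c_C1_0. Qed.

(** * The parameters [a] and [alpha] *)

Section expansion.
Variables (R : realType) (E : (R -> R) -> R[i] -> R[i]).
Hypothesis E_half_plane : forall f z, BLip f -> upper_half_plane z ->
  upper_half_plane (E f z).
Hypothesis E_affine : forall a b : R, 0 < a -> forall z, upper_half_plane z ->
  E (fun x : R => a * x + b) z = a%:C * z + b%:C.
Hypothesis E_comp : forall f g, BLip f -> BLip g ->
  forall z, upper_half_plane z -> E (f \o g) z = E f (E g z).
Hypothesis E_cont : forall (f_ : nat -> R -> R) (f : R -> R),
  (forall n, BLip (f_ n)) -> BLip f -> {family compact, f_ @ \oo --> f} ->
  forall z, upper_half_plane z ->
    (E (f_ n) z : R[i]^o) @[n --> \oo] --> (E f z : R[i]^o).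

Lemma first_order_functional_secant (z0 : R[i]) (e0 : R) (L Rem : (R -> R) -> R[i]) :
  upper_half_plane z0 -> 0 < e0 < 1 -> linear_functional_on (@Cinf_c R) L ->
  (forall phi, Binf e0 phi -> E (fun x : R => x + phi x) z0 = z0 + L phi + Rem phi) ->
  (forall c : R, 0 < c -> exists2 e : R, 0 < e < e0 &
    forall phi, Binf e phi -> `|Rem phi| <= (c * supnorm (derive1 phi) ^+ 2)%:C) ->
  exists a alpha, 0 < alpha /\ forall phi, smooth_c phi ->
    L phi = secant (foot1 a z0) (foot2 a alpha z0) phi z0.
Proof.
move=> Hz He HL Hexp Hrem.
have [chi [chi_smooth chi01 chi1 chi0]] := exists_cutoff R.
have Lcont := L_continuous E_affine E_cont Hz He HL Hexp Hrem.
have LmulX := L_mulX E_half_plane E_affine E_comp E_cont Hz He HL Hexp Hrem.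
have [p [q [qp Lpq]]] := L_two_points Hz (functionalZ HL) (functionalD HL) Lcont LmulX chi_smooth chi01 chi1 chi0.
have y0 : 0 < complex.Im z0 := Hz.
(* Solves [p = Re z0 + a Im z0] and [q = p - alpha Im z0]; [alpha > 0] because [q < p]. *)
exists ((p - complex.Re z0) / complex.Im z0), ((p - q) / complex.Im z0).
split; first by rewrite divr_gt0// subr_gt0.
have -> : foot1 ((p - complex.Re z0) / complex.Im z0) z0 = p.
  by rewrite /foot1; field; rewrite gt_eqF.
have -> : foot2 ((p - complex.Re z0) / complex.Im z0) ((p - q) / complex.Im z0) z0 = q.
  by rewrite /foot2; field; rewrite gt_eqF.
exact: Lpq.
Qed.

End expansion.

Theorem corollary3 (R : realType) (E : (R -> R) -> (R[i] -> R[i]))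
  (E_QC : forall f, @BLip R f -> QC (E f))
  (P1 : forall f, @BLip R f ->
     {family compact,
       (fun (y x : R) => E f (x +i* y) : R[i]^o) @ 0^'+ -->
       (fun x : R => (f x)%:C : R[i]^o)})
  (P2 : forall (a b : R), 0 < a ->
     forall z, upper_half_plane z ->
       E (fun x : R => a * x + b) z = a%:C * z + b%:C)
  (P3 : forall f g, @BLip R f -> @BLip R g ->
     forall z, upper_half_plane z -> E (f \o g) z = E f (E g z))
  (P4 : forall (f_ : nat -> R -> R) (f : R -> R),
     (forall n, BLip (f_ n)) -> BLip f ->
     {family compact, f_ @ \oo --> f} ->
     forall z, upper_half_plane z ->
       (E (f_ n) z : R[i]^o) @[n --> \oo] --> (E f z : R[i]^o)) :
  (forall (z0 : R[i]) (e0 : R) (L : (R -> R) -> R[i]),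
     upper_half_plane z0 -> 0 < e0 < 1 ->
     linear_functional_on (@Cinf_c R) L ->
     (forall phi, Binf e0 phi -> E (fun x : R => x + phi x) z0 = z0 + L phi) ->
     exists a alpha : R, 0 <= alpha /\
       forall f, @BLplus R f ->
         forall z, upper_half_plane z -> E f z = extension a alpha f z)
  /\
  (forall (z0 : R[i]) (e0 : R) (L Rem : (R -> R) -> R[i]),
     upper_half_plane z0 -> 0 < e0 < 1 ->
     linear_functional_on (@C1_0 R) L ->
     bounded_functional_on_C1_0 L ->
     (forall phi, Binf e0 phi ->
        E (fun x : R => x + phi x) z0 = z0 + L phi + Rem phi) ->
     (forall c : R, 0 < c ->
        exists2 e : R, 0 < e < e0 &
          forall phi, Binf e phi ->
            `|Rem phi| <= (c * supnorm phi^`()%classic ^+ 2)%:C) ->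
     exists a alpha : R, 0 <= alpha /\
       forall phi, @C1_0 R phi -> L phi = extension a alpha phi z0).
Proof.
have E_half_plane f z : BLip f -> upper_half_plane z -> upper_half_plane (E f z).
  by move=> /E_QC[[g [+ _ _ _]] _] Hz => /(_ z Hz)[].
split=> [z0 e0 L Hz He HL Hexp|z0 e0 L Rem Hz He HL Lbnd Hexp Hrem].
  have Hexp0 phi : Binf e0 phi -> E (fun x : R => x + phi x) z0 = z0 + L phi + 0.
    by move=> /Hexp ->; rewrite addr0.
  have [|a [alpha [al0 Lsec]]] := first_order_functional_secant E_half_plane P2 P3 P4 Hz He HL
    Hexp0.
    (* The remainder is 0, so any radius strictly between 0 and [e0] will do. *)
    move=> c c0; exists (e0 / 2) => [|phi _].
      by have /andP[h1 h2] := He; apply/andP; split; lra.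
    by rewrite normr0 lecR mulr_ge0 ?sqr_ge0// ltW.
  exists a, alpha; split; first exact: ltW.
  move=> f Hf z Hfz; rewrite extension_secant//.
  exact: (BLplus_is_secant_ext E_half_plane P2 P3 P4 Hz He al0 Hexp Lsec).
have HL' := linear_functional_onS (@Cinf_c_C1_0 R) HL.
have [a [alpha [al0 Lsec]]] := first_order_functional_secant E_half_plane P2 P3 P4 Hz He HL'
  Hexp Hrem.
exists a, alpha; split; first exact: ltW.
move=> phi Hphi; rewrite extension_secant//.
exact: (C1_0_functional_secant HL Lbnd Lsec).
Qed.
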